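(* Let $I_\alpha=[\alpha_{min},\alpha_{max}]$ with $\alpha_{min}>\tfrac{\pi}{2}$, and fix any computational parameters $\epsilon_1,\epsilon_2>0$ and $i_0,j_0,n_{Time},N_{Period},N_{Prune}\in\mathbb{N}$ (positive integers). If $\mathcal{A}$ is the output of the Branch and Prune Algorithm (defined in the context) with these inputs, then $\bigcup_{K\in\mathcal{A}}K$ is $I_\alpha$-exhaustive.
   Context: **Basics.** Wright's equation at parameter $\alpha$ is $x'(t)=-\alpha(e^{x(t-1)}-1)$. A slowly oscillating periodic solution (SOPS) is a periodic solution $x:\mathbb{R}\to\mathbb{R}$ for which there are $q,\bar q>1$, $L=q+\bar q$, such that up to time translation $x>0$ on $(0,q)$, $x<0$ on $(q,L)$ and $x(t+L)=x(t)$ for all $t$. Let $\mathcal{X}=\{x\in C^1(\mathbb{R},\mathbb{R}): x(0)=0,\ x'(0)>0,\ x(t)<0 \text{ for } t\in(-1,0)\}$. For a SOPS $x\in\mathcal{X}$ with consecutive zeros $z_0=0<z_1<z_2$, put $q(x)=z_1-z_0$, $\bar q(x)=z_2-z_1$, $\kappa(x)=(q(x),\bar q(x),x(1))\in\mathbb{R}^3$. A set $K\subset\mathbb{R}^3$ is $I_\alpha$-exhaustive if $\kappa(x)\in K$ for every SOPS $x\in\mathcal{X}$ at any parameter $\alpha\in I_\alpha$. Functions $\ell_K,u_K:\mathbb{R}\to\mathbb{R}$ are bounding functions associated with $K$ if $\ell_K(t)\le x(t)\le u_K(t)$ for all $t$ whenever $x\in\mathcal{X}$ is a SOPS at some $\alpha\in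 I_\alpha$ with $\kappa(x)\in K$. Regions have the form $K=I_q\times I_{\bar q}\times I_M$ with $I_q=[q_{min},q_{max}]$, $I_{\bar q}=[\bar q_{min},\bar q_{max}]$, $I_M=[M_{min},M_{max}]$; $K=\emptyset$ if one of the intervals is empty. Put $L_{min}=q_{min}+\bar q_{min}$, $L_{max}=q_{max}+\bar q_{max}$, $I_L=[L_{min},L_{max}]$. **Pruning Algorithm** (input $I_\alpha,K,\ell_K,u_K,n_{Time}$; output $K',\ell_{K'},u_{K'}$). The steps are done successively, each using the updated data from the previous one; data not mentioned are unchanged. (P1) Replace $u_K(1)$ by $\min\{M_{max},u_K(1)\}$ and $\ell_K(1)$ by $\max\{M_{min},\ell_K(1)\}$; replace $u_K(t)$ by $\min\{0,u_K(t)\}$ for $t\in[-\bar q_{min},0]\cup[q_{max},L_{min}]$; replace $\ell_K(t)$ by $\max\{0,\ell_K(t)\}$ for $t\ne1$ in $[-L_{min},-\bar q_{max}]\cup[0,q_{min}]\cup[L_{max},L_{min}+q_{min}]$. (P2) Let $\Delta=1/n_{Time}$. For $t_0\in\Delta\mathbb{Z}$, $s\in[0,\Delta]$, and with sup/inf over $\alpha\in I_\alpha$, $r\in[0,\Delta]$ and $\ell_K\le x\le u_K$, put $u''(t_0+s)=u_K(t_0)+s\sup[-\alpha(e^{x(t_0-1+r)}-1)]$, $u''(t_0-s)=u_K(t_0)-s\inf[-\alpha(e^{x(t_0-1-r)}-1)]$, $\ell''(t_0+s)=\ell_K(t_0)+s\inf[-\alpha(e^{x(t_0-1+r)}-1)]$,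 $\ell''(t_0-s)=\ell_K(t_0)-s\sup[-\alpha(e^{x(t_0-1-r)}-1)]$; replace $u_K$ by $\min\{u_K,u''\}$ and $\ell_K$ by $\max\{\ell_K,\ell''\}$ at these points. (P3) Replace $I_q$ by $[\inf\{t\in I_q:\ell_K(t)\le0\},\sup\{t\in I_q:u_K(t)\ge0\}]$ and $I_M$ by $I_M\cap[\ell_K(1),u_K(1)]$. (P4) Replace $\ell_K(t)$ by $\max\{\ell_K(t),\min_{L'\in I_L}\ell_K(t+L')\}$ and $u_K(t)$ by $\min\{u_K(t),\max_{L'\in I_L}u_K(t+L')\}$. (P5) If $\ell_K(t)>u_K(t)$ for some $t$, return $K'=\emptyset$. (P6) If $\min_{t\in I_q}\ell_K(t+1)>-\log\frac{\alpha_{min}}{\pi/2}$, return $K'=\emptyset$. Otherwise return the current data. **Auxiliary sequences.** $p_1(t)=\alpha t$, $p_{i+1}(t)=-\alpha\int_0^t(e^{p_i(s-1)}-1)\,ds$ for $t\le1$, evaluated at $\alpha=\alpha_{max}$ in the definitions below. $a_1(\alpha)=-(\alpha-1)$, $a_{j+1}(\alpha)=\alpha(e^{a_j(\alpha)}-1)$. Put $\underline q=1+\inf_{\alpha\in I_\alpha}\frac1\alpha\Big(\frac{\alpha+e^{-\alpha}-1}{\exp\{\alpha+e^{-\alpha}-1\}-1}\Big)$. **Region $K_1$.** $I_q=[\underline q,2]$ if $\alpha_{min}\ge2$ and $I_q=[\underline q,2+\frac1{\alpha_{min}}]$ otherwise; $I_{\bar q}=[1+\frac1{\alpha_{max}},3]$;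 $I_M=[\inf_{\alpha\in I_\alpha}\log(1+\alpha^{-1}\log\frac{\alpha}{\pi/2}),\,p_{i_0}(1)]$; $\ell_{K_1}(0)=u_{K_1}(0)=0$ and $\ell_{K_1}(t)=-\alpha_{max}(e^{\alpha_{max}}-1)$, $u_{K_1}(t)=p_{i_0}(1)$ for $t\ne0$. **Region $K_2$.** (i) Start with $I_q=[\underline q,2+\frac1{\alpha_{min}}]$, $I_{\bar q}=\big[3,\ \sup_{\alpha\in I_\alpha}2+\big|\frac{e^\alpha-1}{e^{a_{j_0}(\alpha)}-1}\big|\big]$, $I_M=[0,p_{i_0}(1)]$. (ii) $\ell(0)=u(0)=0$; $\ell(t)=p_{i_0}(t)$ for $t<0$, $\ell(t)=\inf_{\alpha\in I_\alpha}-\alpha(e^\alpha-1)$ for $t>0$; $u(t)=\sup_{\alpha\in I_\alpha}(-t\,a_{j_0}(\alpha))$ for $t\in[-1,0)$, $u(t)=p_{i_0}(1)$ for all other $t\neq 0$. (iii) Apply (P1) once, then (P2) $N_{Period}$ times restricted to $t_0\in[-4,4]$, then (P3) to $I_q,I_M$. (iv) With the resulting $\ell,u,I_q$, let $m=\min_{t\in I_q}\ell(t+1)$, $U^+=\sup_{q\in I_q}\int_{q-1}^q\max\{e^{u}-1,0\}dt$, $L^+=\inf_{q\in I_q}\int_{q-1}^q\max\{e^{\ell}-1,0\}dt$, $U_1^-=\sup_{q\in I_q}\int_q^{q+1}-\min\{e^{\ell}-1,0\}dt$, $L_1^-=\inf_{q\in I_q}\int_q^{q+1}-\min\{e^{u}-1,0\}dt$,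 and $\bar q_{min}=2+\frac{L^+-U_1^-}{|e^m-1|}$, $\bar q_{max}=2+\frac{U^+-L_1^-}{|e^{u(-1)}-1|}$. If $\bar q_{max}<3$ set $K_2=\emptyset$; otherwise $K_2=I_q\times[\bar q_{min},\bar q_{max}]\times I_M$, with bounding functions $\ell,u$. **Branch and Prune Algorithm.** (1) Set $\mathcal{S}=\{K_1,K_2\}$, $\mathcal{A}=\emptyset$. (2) If $\mathcal{S}=\emptyset$, return $\mathcal{A}$ and stop. (3) Remove some $K$ from $\mathcal{S}$. (4) Replace $(K,u_K,\ell_K)$ by the output of the Pruning Algorithm; repeat $N_{Prune}$ times (if $K=\emptyset$ results, discard it and go to 2). (5) If $\operatorname{diam}K<\epsilon_1$ and $\bar q<3$, or $\operatorname{diam}K<\epsilon_2$ and $\bar q\ge3$ (the case $\bar q<3$ for regions descending from $K_1$, $\bar q\ge3$ for those descending from $K_2$), add $K$ to $\mathcal{A}$ and go to 2. (6) Otherwise bisect $K$ at the midpoint of a longest side into $K_A,K_B$ with $K=K_A\cup K_B$. (7) Add $K_A,K_B$ to $\mathcal{S}$, each with bounding functions $u_K,\ell_K$, and go to 2. *)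

(* Defs.v *)
From Stdlib Require Import Reals ZArith List Relations ClassicalEpsilon.
From Coquelicot Require Import Coquelicot.
Import ListNotations.
Open Scope R_scope.

Definition ite {T : Type} (P : Prop) (a b : T) : T :=
  if excluded_middle_informative P then a else b.

(* All suprema and infima below are those of real sets.  [real] sends both
   infinities to 0, so these two are only used on sets that are nonempty and
   bounded unless the region under treatment contains no solution. *)
Definition Sup (E : R -> Prop) : R := real (Lub_Rbar E).
Definition Inf (E : R -> Prop) : R := real (Glb_Rbar E).

Definition sup_on (a b : R) (f : R -> R) : R :=
  Sup (fun y => exists t, a <= t <= b /\ y = f t).
Definition inf_on (a b : R) (f : R -> R) : R :=
  Inf (fun y => exists t, a <= t <= b /\ y = f t).

(** * Slowly oscillating periodic solutions of Wright's equation *)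

Definition wright_solution (alpha : R) (x : R -> R) : Prop :=
  forall t, is_derive x t (- alpha * (exp (x (t - 1)) - 1)).

Definition SOPS (alpha : R) (x : R -> R) : Prop :=
  wright_solution alpha x /\
  exists q qbar tau : R,
    1 < q /\ 1 < qbar /\
    (forall t, 0 < t < q -> 0 < x (tau + t)) /\
    (forall t, q < t < q + qbar -> x (tau + t) < 0) /\
    (forall t, x (t + (q + qbar)) = x t).

Definition in_X (x : R -> R) : Prop :=
  (forall t, ex_derive x t) /\ (forall t, continuous (Derive x) t) /\
  x 0 = 0 /\ 0 < Derive x 0 /\ (forall t, -1 < t < 0 -> x t < 0).

Definition consecutive_zeros (x : R -> R) (z z' : R) : Prop :=
  z < z' /\ x z = 0 /\ x z' = 0 /\ (forall t, z < t < z' -> x t <> 0).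

(* [is_kappa x (q, qbar, M)] is the graph of kappa. *)
Definition is_kappa (x : R -> R) (k : R * R * R) : Prop :=
  exists z1 z2, consecutive_zeros x 0 z1 /\ consecutive_zeros x z1 z2 /\
    k = (z1 - 0, z2 - z1, x 1).

Definition exhaustive (alpha_min alpha_max : R) (K : R * R * R -> Prop) : Prop :=
  forall alpha x, alpha_min <= alpha <= alpha_max -> SOPS alpha x -> in_X x ->
    exists k, is_kappa x k /\ K k.

(** * Regions with their bounding functions *)

Record params := Params {
  alpha_min : R; alpha_max : R;
  eps1 : R; eps2 : R;
  i0 : nat; j0 : nat;
  n_time : nat; n_period : nat; n_prune : nat }.

(* An interval is empty when its lower end exceeds its upper end. *)
Record box := Box {
  q_min : R; q_max : R;
  qb_min : R; qb_max : R;
  M_min : R; M_max : R }.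

Definition in_box (K : box) (k : R * R * R) : Prop :=
  let '(q, qb, M) := k in
  q_min K <= q <= q_max K /\ qb_min K <= qb <= qb_max K /\
  M_min K <= M <= M_max K.

Definition L_min (K : box) : R := q_min K + qb_min K.
Definition L_max (K : box) : R := q_max K + qb_max K.

Definition dist3 (k k' : R * R * R) : R :=
  let '(a, b, c) := k in let '(a', b', c') := k' in
  sqrt ((a - a') ^ 2 + (b - b') ^ 2 + (c - c') ^ 2).

Definition diam (K : box) : R :=
  Sup (fun d => exists k k', in_box K k /\ in_box K k' /\ d = dist3 k k').

Inductive origin := from_K1 | from_K2.

Record region := Region {
  rbox :> box;
  ell : R -> R;
  upp : R -> R;
  orig : origin }.

(** * The Pruning Algorithm *)

Definition P1 (K : region) : region :=
  Region K
    (fun t => ite (t = 1) (Rmax (M_min K) (ell K 1))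
      (ite (- L_min K <= t <= - qb_max K \/ 0 <= t <= q_min K \/
            L_max K <= t <= L_min K + q_min K)
         (Rmax 0 (ell K t)) (ell K t)))
    (fun t => let v := ite (t = 1) (Rmin (M_max K) (upp K 1)) (upp K t) in
      ite (- qb_min K <= t <= 0 \/ q_max K <= t <= L_min K) (Rmin 0 v) v)
    (orig K).

(* The values -alpha (e^{x (t0 - 1 + sgn r)} - 1) over which (P2) takes
   suprema and infima; sgn is 1 or -1. *)
Definition slopes (P : params) (K : region) (t0 sgn : R) (y : R) : Prop :=
  exists (alpha r : R) (x : R -> R),
    alpha_min P <= alpha <= alpha_max P /\
    0 <= r <= / INR (n_time P) /\
    (forall t, ell K t <= x t <= upp K t) /\
    y = - alpha * (exp (x (t0 - 1 + sgn * r)) - 1).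

(* A point t can be reached from several grid points t0 (from the left and from
   the right); [upp''] and [ell''] are the finite sets of all values so
   obtained from the grid points in G, and (P2) uses every one of them. *)
Definition upp'' (P : params) (G : R -> Prop) (K : region) (t y : R) : Prop :=
  let Delta := / INR (n_time P) in
  exists (n : Z) (s : R), let t0 := IZR n * Delta in
    G t0 /\ 0 <= s <= Delta /\
    ((t = t0 + s /\ y = upp K t0 + s * Sup (slopes P K t0 1)) \/
     (t = t0 - s /\ y = upp K t0 - s * Inf (slopes P K t0 (-1)))).

Definition ell'' (P : params) (G : R -> Prop) (K : region) (t y : R) : Prop :=
  let Delta := / INR (n_time P) in
  exists (n : Z) (s : R), let t0 := IZR n * Delta in
    G t0 /\ 0 <= s <= Delta /\
    ((t = t0 + s /\ y = ell K t0 + s * Inf (slopes P K t0 1)) \/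
     (t = t0 - s /\ y = ell K t0 - s * Sup (slopes P K t0 (-1)))).

Definition P2 (P : params) (G : R -> Prop) (K : region) : region :=
  Region K
    (fun t => Sup (fun y => y = ell K t \/ ell'' P G K t y))
    (fun t => Inf (fun y => y = upp K t \/ upp'' P G K t y))
    (orig K).

(* [None] is the empty region.  The new ends of I_q are extended reals: when
   one of the two sets is empty, so is the new I_q. *)
Definition P3 (K : region) : option region :=
  let lo := Glb_Rbar (fun t => q_min K <= t <= q_max K /\ ell K t <= 0) in
  let hi := Lub_Rbar (fun t => q_min K <= t <= q_max K /\ 0 <= upp K t) in
  ite (Rbar_le lo hi)
    (Some (Region
      (Box (real lo) (real hi) (qb_min K) (qb_max K)
           (Rmax (M_min K) (ell K 1)) (Rmin (M_max K) (upp K 1)))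
      (ell K) (upp K) (orig K)))
    None.

Definition P4 (K : region) : region :=
  Region K
    (fun t => Rmax (ell K t) (inf_on (L_min K) (L_max K) (fun L => ell K (t + L))))
    (fun t => Rmin (upp K t) (sup_on (L_min K) (L_max K) (fun L => upp K (t + L))))
    (orig K).

Definition P5_empty (K : region) : Prop := exists t, ell K t > upp K t.

Definition P6_empty (P : params) (K : region) : Prop :=
  inf_on (q_min K) (q_max K) (fun t => ell K (t + 1))
    > - ln (alpha_min P / (PI / 2)).

Definition box_empty (K : box) : Prop := ~ exists k, in_box K k.

Definition prune (P : params) (K : region) : option region :=
  match P3 (P2 P (fun _ => True) (P1 K)) with
  | None => None
  | Some K3 =>
      let K4 := P4 K3 in
      ite (P5_empty K4 \/ P6_empty P K4 \/ box_empty K4) None (Some K4)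
  end.

Definition prune_iter (P : params) (n : nat) (K : region) : option region :=
  Nat.iter n (fun o => match o with Some K' => prune P K' | None => None end)
    (Some K).

(** * The initial regions *)

(* Indices start at 1. *)
Definition p_seq (alpha : R) (i : nat) : R -> R :=
  Nat.iter (i - 1)
    (fun p t => - alpha * RInt (fun s => exp (p (s - 1)) - 1) 0 t)
    (fun t => alpha * t).

Definition a_seq (j : nat) (alpha : R) : R :=
  Nat.iter (j - 1) (fun a => alpha * (exp a - 1)) (- (alpha - 1)).

Definition p_i0 (P : params) : R -> R := p_seq (alpha_max P) (i0 P).

Definition sup_alpha (P : params) : (R -> R) -> R :=
  sup_on (alpha_min P) (alpha_max P).
Definition inf_alpha (P : params) : (R -> R) -> R :=
  inf_on (alpha_min P) (alpha_max P).

Definition q_under (P : params) : R :=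
  1 + inf_alpha P (fun alpha =>
    1 / alpha * ((alpha + exp (- alpha) - 1)
                 / (exp (alpha + exp (- alpha) - 1) - 1))).

Definition K1 (P : params) : region :=
  Region
    (Box (q_under P)
         (ite (2 <= alpha_min P) 2 (2 + 1 / alpha_min P))
         (1 + 1 / alpha_max P) 3
         (inf_alpha P (fun alpha => ln (1 + / alpha * ln (alpha / (PI / 2)))))
         (p_i0 P 1))
    (fun t => ite (t = 0) 0 (- alpha_max P * (exp (alpha_max P) - 1)))
    (fun t => ite (t = 0) 0 (p_i0 P 1))
    from_K1.

Definition K2_start (P : params) : region :=
  Region
    (Box (q_under P) (2 + 1 / alpha_min P)
         3
         (sup_alpha P (fun alpha =>
            2 + Rabs ((exp alpha - 1) / (exp (a_seq (j0 P) alpha) - 1))))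
         0 (p_i0 P 1))
    (fun t => ite (t = 0) 0
       (ite (t < 0) (p_i0 P t)
          (inf_alpha P (fun alpha => - alpha * (exp alpha - 1)))))
    (fun t => ite (t = 0) 0
       (ite (-1 <= t < 0) (sup_alpha P (fun alpha => - t * a_seq (j0 P) alpha))
          (p_i0 P 1)))
    from_K2.

Definition K2_refined (P : params) : option region :=
  P3 (Nat.iter (n_period P) (P2 P (fun t0 => -4 <= t0 <= 4)) (P1 (K2_start P))).

Definition K2 (P : params) : option region :=
  match K2_refined P with
  | None => None
  | Some K =>
      let over_q := sup_on (q_min K) (q_max K) in
      let under_q := inf_on (q_min K) (q_max K) in
      let m := under_q (fun t => ell K (t + 1)) in
      let Uplus := over_q (fun q =>
        RInt (fun t => Rmax (exp (upp K t) - 1) 0) (q - 1) q) in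
      let Lplus := under_q (fun q =>
        RInt (fun t => Rmax (exp (ell K t) - 1) 0) (q - 1) q) in
      let U1minus := over_q (fun q =>
        RInt (fun t => - Rmin (exp (ell K t) - 1) 0) q (q + 1)) in
      let L1minus := under_q (fun q =>
        RInt (fun t => - Rmin (exp (upp K t) - 1) 0) q (q + 1)) in
      let qbmin := 2 + (Lplus - U1minus) / Rabs (exp m - 1) in
      let qbmax := 2 + (Uplus - L1minus) / Rabs (exp (upp K (-1)) - 1) in
      ite (qbmax < 3) None
        (Some (Region
          (Box (q_min K) (q_max K) qbmin qbmax (M_min K) (M_max K))
          (ell K) (upp K) (orig K)))
  end.

(** * The Branch and Prune Algorithm *)

Definition width_q (K : box) : R := q_max K - q_min K.
Definition width_qb (K : box) : R := qb_max K - qb_min K.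
Definition width_M (K : box) : R := M_max K - M_min K.

Inductive bisect_box : box -> box -> box -> Prop :=
| bisect_q a b c d e f :
    let K := Box a b c d e f in
    width_qb K <= width_q K -> width_M K <= width_q K ->
    bisect_box K (Box a ((a + b) / 2) c d e f) (Box ((a + b) / 2) b c d e f)
| bisect_qb a b c d e f :
    let K := Box a b c d e f in
    width_q K <= width_qb K -> width_M K <= width_qb K ->
    bisect_box K (Box a b c ((c + d) / 2) e f) (Box a b ((c + d) / 2) d e f)
| bisect_M a b c d e f :
    let K := Box a b c d e f in
    width_q K <= width_M K -> width_qb K <= width_M K ->
    bisect_box K (Box a b c d e ((e + f) / 2)) (Box a b c d ((e + f) / 2) f).

Definition small (P : params) (K : region) : Prop :=
  diam K < match orig K with from_K1 => eps1 P | from_K2 => eps2 P end.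

(* One pass through the main loop on the pair (S, A); which region is removed
   from S, and which longest side is bisected in case of a tie, is left open. *)
Inductive bp_step (P : params) :
  list region * list region -> list region * list region -> Prop :=
| bp_discard S1 S2 A K :
    prune_iter P (n_prune P) K = None ->
    bp_step P (S1 ++ K :: S2, A) (S1 ++ S2, A)
| bp_accept S1 S2 A K K' :
    prune_iter P (n_prune P) K = Some K' -> small P K' ->
    bp_step P (S1 ++ K :: S2, A) (S1 ++ S2, K' :: A)
| bp_split S1 S2 A K K' KA KB :
    prune_iter P (n_prune P) K = Some K' -> ~ small P K' ->
    bisect_box K' KA KB ->
    bp_step P (S1 ++ K :: S2, A)
      (Region KA (ell K') (upp K') (orig K') ::
       Region KB (ell K') (upp K') (orig K') :: S1 ++ S2, A).

(* An empty K2 is not put on the list, which amounts to discarding it. *)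
Definition bp_init (P : params) : list region :=
  K1 P :: match K2 P with Some K => [K] | None => [] end.

Definition bp_output (P : params) (A : list region) : Prop :=
  clos_refl_trans _ (bp_step P) (bp_init P, []) ([], A).

(* Main.v *)
(* A solution x is followed through the algorithm: every region that contains
   kappa(x) and whose bounding functions enclose x keeps these two properties
   under pruning, and passes them to one half under bisection; so it suffices
   that K_1 (when qbar <= 3) or K_2 (when qbar >= 3) has them.

   The only deep ingredient is the amplitude bound min x < -log(alpha/(pi/2)),
   used in (P6) and for the lower end of I_M.  Write f(y) = alpha(e^y - 1) and
   g(y) = f(y) - (pi/2) y.  If the bound fails, then g is nondecreasing on the
   range of x.  Let A(u) = int x(s-u) x'(s) ds and J(u) = int g(x(s-u)) x'(s) ds
   over one period.  Comparing the rising and the falling branch of x level by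
   level gives J <= 0 on [0,1], with J(1) = - int f(x) g(x) < 0.  But the equation
   gives J(u) = A'(1-u) - (pi/2) A(u), where A(0) = 0, and then the function
   cos(pi u/2) A(u) + (pi/2) (E(u) + E(1-u)) with E' = sin(pi u/2) A(u) takes the
   same value at 0 and 1 while its derivative is cos(pi u/2) J(1-u). *)
Require Import Defs.
From Stdlib Require Import Reals List.
From Stdlib Require Import Lra Lia ZArith Relations ClassicalEpsilon.
From Coquelicot Require Import Coquelicot.
Import ListNotations.
Open Scope R_scope.

(** * Differential inequalities *)

(** The number pi/2 enters because x'(t) = -a x(t-1) has the periodic solution sin(pi t/2) exactly
    at a = pi/2. Accordingly sin(pi u/2) solves A'(1-u) = (pi/2) A(u) with A(0) = 0, and cos(pi u/2)
    is the multiplier that annihilates this reflected operator. Integrate cos(pi u/2) J(1-u) =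
    cos(pi u/2) (A'(u) - (pi/2) A(1-u)) by parts over [0,1]: the boundary terms vanish by A(0) = 0
    and cos(pi/2) = 0, and the two remaining integrals of sin(pi u/2) A(u) cancel after u -> 1-u. So
    a positively weighted mean of J is 0, against J <= 0 and J(1) < 0. A second obstacle lies in
    K_2. Its interval for qbar is made of values of [RInt], which say nothing unless the integrand
    is integrable, and the bounding functions arise as pointwise suprema and infima. Their
    integrability therefore has to be carried through the refinement, together with the strict
    negativity of the upper bound at -1, whose exponential minus 1 is a divisor. *)

Lemma is_derive_increasing (f df : R -> R) (a b : R) :
  a <= b ->
  (forall t, a <= t <= b -> is_derive f t (df t)) ->
  (forall t, a < t < b -> 0 <= df t) -> f a <= f b.
Proof.
  intros [Hab | ->] Hd Hp; [| lra].
  destruct (MVT_cor2 f df a b Hab) as [c [Hc Hin]].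
  - intros c Hc. apply is_derive_Reals, Hd, Hc.
  - assert (0 <= df c * (b - a)) by (apply Rmult_le_pos; [apply Hp |]; lra). lra.
Qed.

Lemma is_derive_strictly_increasing (f df : R -> R) (a b : R) :
  a < b ->
  (forall t, a <= t <= b -> is_derive f t (df t)) ->
  (forall t, a < t < b -> 0 < df t) -> f a < f b.
Proof.
  intros Hab Hd Hp.
  destruct (MVT_cor2 f df a b Hab) as [c [Hc Hin]].
  - intros c Hc. apply is_derive_Reals, Hd, Hc.
  - assert (0 < df c * (b - a)) by (apply Rmult_lt_0_compat; [apply Hp |]; lra). lra.
Qed.

Lemma is_derive_compare (f g df dg : R -> R) (a b : R) :
  a <= b ->
  (forall t, a <= t <= b -> is_derive f t (df t)) ->
  (forall t, a <= t <= b -> is_derive g t (dg t)) ->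
  (forall t, a < t < b -> df t <= dg t) -> f b - f a <= g b - g a.
Proof.
  intros Hab Hf Hg Hle.
  assert (H := is_derive_increasing (fun t => g t - f t) (fun t => dg t - df t) a b Hab).
  assert (g a - f a <= g b - f b); [| lra].
  apply H.
  - intros t Ht. apply (is_derive_minus g f); auto.
  - intros t Ht. specialize (Hle t Ht). lra.
Qed.

Lemma is_derive_bound_above (f df : R -> R) (a b k : R) :
  a <= b ->
  (forall t, a <= t <= b -> is_derive f t (df t)) ->
  (forall t, a < t < b -> df t <= k) -> f b - f a <= k * (b - a).
Proof.
  intros Hab Hf Hle.
  replace (k * (b - a)) with (k * b - k * a) by ring.
  apply (is_derive_compare f (fun t => k * t) df (fun _ => k)); auto.
  intros t _. auto_derive; auto; ring.
Qed.

Lemma is_derive_bound_below (f df : R -> R) (a b k : R) :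
  a <= b ->
  (forall t, a <= t <= b -> is_derive f t (df t)) ->
  (forall t, a < t < b -> k <= df t) -> k * (b - a) <= f b - f a.
Proof.
  intros Hab Hf Hle.
  replace (k * (b - a)) with (k * b - k * a) by ring.
  apply (is_derive_compare (fun t => k * t) f (fun _ => k) df); auto.
  intros t _. auto_derive; auto; ring.
Qed.

Lemma continuous_of_is_derive (f : R -> R) (t d : R) :
  is_derive f t d -> continuous f t.
Proof. intros H. apply (ex_derive_continuous f). now exists d. Qed.

Lemma ex_RInt_continuous_R (f : R -> R) (a b : R) :
  (forall t, continuous f t) -> ex_RInt f a b.
Proof. intros Hf. apply (ex_RInt_continuous (V := R_CompleteNormedModule)). auto. Qed.

Lemma is_derive_RInt_upper (f : R -> R) (a t : R) :
  (forall s, continuous f s) -> is_derive (fun u => RInt f a u) t (f t).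
Proof.
  intros Hf. apply (is_derive_RInt f (RInt f a) a); [| apply Hf].
  apply filter_forall. intros u.
  apply (RInt_correct (V := R_CompleteNormedModule)), ex_RInt_continuous_R, Hf.
Qed.

(** * Elementary inequalities for the exponential *)

Lemma exp_le (a b : R) : a <= b -> exp a <= exp b.
Proof. intros [H | ->]; [left; now apply exp_increasing | lra]. Qed.

Lemma exp_gt_1 (a : R) : 0 < a -> 1 < exp a.
Proof. intros H. rewrite <- exp_0. now apply exp_increasing. Qed.

Lemma exp_lt_1 (a : R) : a < 0 -> exp a < 1.
Proof. intros H. rewrite <- exp_0. now apply exp_increasing. Qed.

Lemma exp_ge_1_plus (a : R) : 1 + a <= exp a.
Proof.
  destruct (Req_dec a 0) as [-> | H]; [rewrite exp_0; lra |].
  left. now apply exp_ineq1.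
Qed.

(** * The shape of a slowly oscillating periodic solution *)

(** A SOPS with its time translation already removed: the positive arch starts at 0, so [q] and [qb]
    are the first two entries of kappa. *)
Record wave (alpha : R) (x : R -> R) (q qb : R) : Prop := Wave {
  wave_alpha : 0 < alpha;
  wave_sol : wright_solution alpha x;
  wave_q : 1 < q;
  wave_qb : 1 < qb;
  wave_pos : forall t, 0 < t < q -> 0 < x t;
  wave_neg : forall t, q < t < q + qb -> x t < 0;
  wave_per : forall t, x (t + (q + qb)) = x t }.

Lemma periodic_Z (f : R -> R) (L : R) (n : Z) (t : R) :
  (forall t, f (t + L) = f t) -> f (t + IZR n * L) = f t.
Proof.
  intros Hper.
  assert (Hnat : forall (n : nat) t, f (t + INR n * L) = f t).
  { induction n0 as [| m IH]; intros s.
    - simpl. f_equal. ring.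
    - rewrite S_INR. replace (s + (INR m + 1) * L) with ((s + INR m * L) + L) by ring.
      now rewrite Hper. }
  destruct (Z_le_gt_dec 0 n) as [Hn | Hn].
  - rewrite <- (Z2Nat.id n) by lia. rewrite <- INR_IZR_INZ. apply Hnat.
  - rewrite <- (Hnat (Z.to_nat (- n)) (t + IZR n * L)).
    f_equal. rewrite INR_IZR_INZ, Z2Nat.id by lia. rewrite opp_IZR. ring.
Qed.

Lemma fundamental_domain (L a t : R) :
  0 < L -> exists n : Z, a <= t - IZR n * L < a + L.
Proof.
  intros HL. destruct (archimed ((t - a) / L)) as [H1 H2].
  exists (up ((t - a) / L) - 1)%Z. rewrite minus_IZR.
  apply (Rmult_lt_compat_r L) in H1; [| lra].
  apply (Rmult_le_compat_r L) in H2; [| lra].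
  replace ((t - a) / L * L) with (t - a) in H1 by (field; lra).
  rewrite Rmult_minus_distr_r in H2.
  replace ((t - a) / L * L) with (t - a) in H2 by (field; lra).
  lra.
Qed.

Lemma continuous_pos_locally (f : R -> R) (t : R) :
  continuous f t -> 0 < f t -> exists d, 0 < d /\ forall s, t - d < s < t + d -> 0 < f s.
Proof.
  intros Hc Hp.
  destruct (Hc (fun y => 0 < y)) as [d Hd].
  - exists (mkposreal _ Hp). intros y Hy. unfold ball in Hy; simpl in Hy.
    unfold AbsRing_ball, abs, minus, plus, opp in Hy; simpl in Hy.
    apply Rabs_def2 in Hy. lra.
  - exists d. split; [apply cond_pos |]. intros s Hs. apply Hd.
    unfold ball; simpl. unfold AbsRing_ball, abs, minus, plus, opp; simpl.
    apply Rabs_def1; lra.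
Qed.

Lemma continuous_ge_0_right (f : R -> R) (t d : R) :
  0 < d -> continuous f t -> (forall s, t < s < t + d -> 0 <= f s) -> 0 <= f t.
Proof.
  intros Hd Hc Hs. destruct (Rle_lt_dec 0 (f t)) as [H | H]; auto. exfalso.
  destruct (continuous_pos_locally (fun s => - f s) t) as [e [He1 He2]].
  - apply (continuous_opp f); auto.
  - lra.
  - set (s := t + Rmin d e / 2).
    assert (0 < Rmin d e) by (apply Rmin_pos; auto).
    assert (Rmin d e <= d) by apply Rmin_l. assert (Rmin d e <= e) by apply Rmin_r.
    specialize (Hs s). specialize (He2 s). unfold s in *.
    assert (0 <= f (t + Rmin d e / 2)) by (apply Hs; lra).
    assert (0 < - f (t + Rmin d e / 2)) by (apply He2; lra). lra.
Qed.

Lemma continuous_ge_0_left (f : R -> R) (t d : R) :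
  0 < d -> continuous f t -> (forall s, t - d < s < t -> 0 <= f s) -> 0 <= f t.
Proof.
  intros Hd Hc Hs.
  replace t with (- - t) by ring.
  apply (continuous_ge_0_right (fun s => f (- s)) (- t) d Hd).
  - apply (continuous_comp (fun s => - s) f).
    + apply (ex_derive_continuous (fun s : R => - s)). auto_derive. exact I.
    + now rewrite Ropp_involutive.
  - intros s Hs'. apply Hs. lra.
Qed.

Section Wave.
Context {alpha : R} {x : R -> R} {q qb : R} (W : wave alpha x q qb).

Lemma wave_derive (t : R) : is_derive x t (- alpha * (exp (x (t - 1)) - 1)).
Proof. apply (wave_sol _ _ _ _ W). Qed.

Lemma wave_continuous (t : R) : continuous x t.
Proof. eapply continuous_of_is_derive, wave_derive. Qed.

Lemma wave_per_Z (n : Z) (t : R) : x (t + IZR n * (q + qb)) = x t.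
Proof. apply periodic_Z, (wave_per _ _ _ _ W). Qed.

Lemma wave_per_sub (t : R) : x (t - (q + qb)) = x t.
Proof. rewrite <- (wave_per _ _ _ _ W (t - (q + qb))). f_equal. ring. Qed.

Lemma wave_0 : x 0 = 0.
Proof.
  pose proof (wave_q _ _ _ _ W). pose proof (wave_qb _ _ _ _ W).
  apply Rle_antisym.
  - assert (0 <= - x 0); [| lra].
    apply (continuous_ge_0_left (fun s => - x s) 0 1); [lra | |].
    + apply (continuous_opp x), wave_continuous.
    + intros s Hs. rewrite <- (wave_per _ _ _ _ W s).
      assert (x (s + (q + qb)) < 0) by (apply (wave_neg _ _ _ _ W); lra). lra.
  - apply (continuous_ge_0_right x 0 1); [lra | apply wave_continuous |].
    intros s Hs. left. apply (wave_pos _ _ _ _ W). lra.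
Qed.

Lemma wave_zq : x q = 0.
Proof.
  pose proof (wave_q _ _ _ _ W). pose proof (wave_qb _ _ _ _ W).
  apply Rle_antisym.
  - assert (0 <= - x q); [| lra].
    apply (continuous_ge_0_right (fun s => - x s) q 1); [lra | |].
    + apply (continuous_opp x), wave_continuous.
    + intros s Hs.
      assert (x s < 0) by (apply (wave_neg _ _ _ _ W); lra). lra.
  - apply (continuous_ge_0_left x q 1); [lra | apply wave_continuous |].
    intros s Hs. left. apply (wave_pos _ _ _ _ W). lra.
Qed.

Lemma wave_zL : x (q + qb) = 0.
Proof. rewrite <- wave_0, <- (wave_per _ _ _ _ W 0). f_equal. ring. Qed.

Lemma wave_neg_before (t : R) : - qb < t < 0 -> x t < 0.
Proof.
  intros Ht. rewrite <- (wave_per _ _ _ _ W). apply (wave_neg _ _ _ _ W). lra.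
Qed.

Lemma wave_nonneg (t : R) : 0 <= t <= q -> 0 <= x t.
Proof.
  intros Ht. destruct (Req_dec t 0) as [-> | H1]; [rewrite wave_0; lra |].
  destruct (Req_dec t q) as [-> | H2]; [rewrite wave_zq; lra |].
  left. apply (wave_pos _ _ _ _ W). lra.
Qed.

Lemma wave_nonpos (t : R) : q <= t <= q + qb -> x t <= 0.
Proof.
  intros Ht. destruct (Req_dec t q) as [-> | H1]; [rewrite wave_zq; lra |].
  destruct (Req_dec t (q + qb)) as [-> | H2]; [rewrite wave_zL; lra |].
  left. apply (wave_neg _ _ _ _ W). lra.
Qed.

Lemma wave_nonpos_before (t : R) : - qb <= t <= 0 -> x t <= 0.
Proof.
  intros Ht. rewrite <- (wave_per _ _ _ _ W). apply wave_nonpos. lra.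
Qed.

(** The sign of the slope at [t] is opposite to that of [x (t - 1)], so the rising branch is the
    negative arch (-qb, 0) delayed by one. *)
Lemma wave_increasing (s t : R) : 1 - qb <= s -> s < t -> t <= 1 -> x s < x t.
Proof.
  intros H1 H2 H3.
  apply (is_derive_strictly_increasing x (fun t => - alpha * (exp (x (t - 1)) - 1)));
    [lra | intros; apply wave_derive |].
  intros r Hr. pose proof (wave_alpha _ _ _ _ W).
  assert (Hx : x (r - 1) < 0) by (apply wave_neg_before; lra).
  apply exp_lt_1 in Hx. nra.
Qed.

Lemma wave_decreasing (s t : R) : 1 <= s -> s < t -> t <= 1 + q -> x t < x s.
Proof.
  intros H1 H2 H3.
  apply Ropp_lt_cancel.
  apply (is_derive_strictly_increasing (fun t => - x t) (fun t => alpha * (exp (x (t - 1)) - 1)));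
    [lra | |].
  - intros r _. replace (alpha * (exp (x (r - 1)) - 1)) with (- (- alpha * (exp (x (r - 1)) - 1))) by ring.
    apply (is_derive_opp x), wave_derive.
  - intros r Hr. pose proof (wave_alpha _ _ _ _ W).
    assert (Hx : 0 < x (r - 1)) by (apply (wave_pos _ _ _ _ W); lra).
    apply exp_gt_1 in Hx. nra.
Qed.

Lemma wave_increasing_le (s t : R) : 1 - qb <= s -> s <= t -> t <= 1 -> x s <= x t.
Proof. intros H1 [H2 | ->] H3; [left; now apply wave_increasing | lra]. Qed.

Lemma wave_decreasing_le (s t : R) : 1 <= s -> s <= t -> t <= 1 + q -> x t <= x s.
Proof. intros H1 [H2 | ->] H3; [left; now apply wave_decreasing | lra]. Qed.

Lemma wave_min_eq : x (1 - qb) = x (1 + q).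
Proof. rewrite <- (wave_per _ _ _ _ W (1 - qb)). f_equal. ring. Qed.

(** The period [1 - qb, 1 + q] is one rising branch up to time 1 followed by one falling branch;
    both of its ends carry the minimum. *)
Lemma wave_range (t : R) : x (1 + q) <= x t <= x 1.
Proof.
  pose proof (wave_q _ _ _ _ W). pose proof (wave_qb _ _ _ _ W).
  destruct (fundamental_domain (q + qb) (1 - qb) t) as [n Hn]; [lra |].
  assert (E : x t = x (t - IZR n * (q + qb))).
  { rewrite <- (wave_per_Z (- n) t). rewrite opp_IZR. f_equal. ring. }
  rewrite E. set (s := t - IZR n * (q + qb)) in *.
  destruct (Rle_dec s 1).
  - split; [rewrite <- wave_min_eq |]; apply wave_increasing_le; lra.
  - split; apply wave_decreasing_le; lra.
Qed.

Lemma wave_max_pos : 0 < x 1.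
Proof. apply (wave_pos _ _ _ _ W). pose proof (wave_q _ _ _ _ W). lra. Qed.

Lemma wave_min_neg : x (1 + q) < 0.
Proof. apply (wave_neg _ _ _ _ W). pose proof (wave_qb _ _ _ _ W). lra. Qed.

Lemma wave_is_kappa : is_kappa x (q, qb, x 1).
Proof.
  pose proof (wave_q _ _ _ _ W). pose proof (wave_qb _ _ _ _ W).
  exists q, (q + qb). split; [| split].
  - split; [lra |]. split; [apply wave_0 |]. split; [apply wave_zq |].
    intros t Ht E. pose proof (wave_pos _ _ _ _ W t Ht). lra.
  - split; [lra |]. split; [apply wave_zq |]. split; [apply wave_zL |].
    intros t Ht E. pose proof (wave_neg _ _ _ _ W t Ht). lra.
  - f_equal; f_equal; ring.
Qed.

End Wave.

(** The phase [r] of time 0 relative to the translation must vanish: [x 0 = 0] excludes the two open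
    arches, and [r = q] is excluded because x is positive just before [q] but negative just before
    0. *)
Lemma SOPS_wave (alpha : R) (x : R -> R) :
  0 < alpha -> SOPS alpha x -> in_X x -> exists q qb, wave alpha x q qb.
Proof.
  intros Ha [Hsol [q [qb [tau [Hq [Hqb [Hpos [Hneg Hper]]]]]]]] [_ [_ [H0 [_ Hbef]]]].
  exists q, qb.
  destruct (fundamental_domain (q + qb) tau 0) as [n Hn]; [lra |].
  set (r := - tau - IZR n * (q + qb)).
  assert (Hr : 0 <= r < q + qb) by (unfold r; lra).
  assert (Hshift : forall t, x (tau + (r + t)) = x t).
  { intros t. rewrite <- (periodic_Z x (q + qb) (- n) t Hper). rewrite opp_IZR.
    f_equal. unfold r. ring. }
  assert (Hr0 : r = 0).
  { destruct (Req_dec r 0) as [| Hne]; auto. exfalso.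
    destruct (Rtotal_order r q) as [H | [H | H]].
    - specialize (Hpos r). rewrite <- (Rplus_0_r r), Hshift in Hpos. lra.
    - assert (Hp := Hpos (r + - (1/2))). rewrite Hshift in Hp.
      specialize (Hbef (- (1/2))). lra.
    - specialize (Hneg r). rewrite <- (Rplus_0_r r), Hshift in Hneg. lra. }
  assert (Hsh : forall t, x (tau + t) = x t).
  { intros t. rewrite <- (Hshift t), Hr0. f_equal. ring. }
  constructor; auto.
  - intros t Ht. rewrite <- Hsh. auto.
  - intros t Ht. rewrite <- Hsh. auto.
Qed.

(** It converts an upper bound on the maximum into a lower bound on q. After cross-multiplication
    the difference vanishes at z = y, and its z-derivative y e^z - (e^y - 1) is nonnegative by 1 - y
    <= e^(-y). *)
Lemma div_exp_minus_1_antitone (y z : R) :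
  0 < y -> y <= z -> z / (exp z - 1) <= y / (exp y - 1).
Proof.
  intros Hy Hyz.
  assert (Hey := exp_gt_1 y Hy). assert (Hez : 1 < exp z) by (apply exp_gt_1; lra).
  assert (H : z * (exp y - 1) <= y * (exp z - 1)).
  { assert (K := is_derive_increasing (fun z => y * (exp z - 1) - z * (exp y - 1))
                   (fun z => y * exp z - (exp y - 1)) y z Hyz).
    cbv beta in K. rewrite Rminus_diag in K.
    assert (0 <= y * (exp z - 1) - z * (exp y - 1)); [apply K | lra].
    - intros t _. auto_derive; auto. ring.
    - intros t Ht. assert (exp y <= exp t) by (apply exp_le; lra).
      assert (H1 := exp_ge_1_plus (- y)).
      assert (H2 : exp y * exp (- y) = 1) by (rewrite <- exp_plus, Rplus_opp_r; apply exp_0).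
      nra. }
  apply (Rmult_le_reg_r ((exp z - 1) * (exp y - 1))); [apply Rmult_lt_0_compat; lra |].
  replace (z / (exp z - 1) * ((exp z - 1) * (exp y - 1))) with (z * (exp y - 1)) by (field; lra).
  replace (y / (exp y - 1) * ((exp z - 1) * (exp y - 1))) with (y * (exp z - 1)) by (field; lra).
  exact H.
Qed.

(** * A priori bounds on the zeros, the extrema and the values before 0 *)

Section Estimates.
Context {alpha : R} {x : R -> R} {q qb : R} (W : wave alpha x q qb).

Lemma wave_rise_le (s t : R) : s <= t -> x t - x s <= alpha * (t - s).
Proof.
  intros Hst. apply (is_derive_bound_above x (fun t => - alpha * (exp (x (t - 1)) - 1))); auto.
  - intros; apply (wave_derive W).
  - intros r _. pose proof (wave_alpha _ _ _ _ W). pose proof (exp_pos (x (r - 1))). nra.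
Qed.

Lemma wave_before_ge (t : R) : t <= 0 -> alpha * t <= x t.
Proof. intros Ht. assert (H := wave_rise_le t 0 Ht). rewrite (wave_0 W) in H. lra. Qed.

Lemma wave_max_le_alpha : x 1 <= alpha.
Proof. assert (H := wave_rise_le 0 1 ltac:(lra)). rewrite (wave_0 W) in H. lra. Qed.

(** The line [alpha * t], which lies below x for t <= 0, is fed once into the equation. The constant
    is p_2(1) at the solution's own parameter. *)
Lemma wave_max_le : x 1 <= alpha + exp (- alpha) - 1.
Proof.
  assert (H : x 1 - x 0 <= (alpha * 1 - exp (alpha * (1 - 1))) - (alpha * 0 - exp (alpha * (0 - 1)))).
  { apply (is_derive_compare x (fun t => alpha * t - exp (alpha * (t - 1)))
             (fun t => - alpha * (exp (x (t - 1)) - 1))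
             (fun t => alpha - alpha * exp (alpha * (t - 1)))); [lra | | |].
    - intros; apply (wave_derive W).
    - intros t _. auto_derive; auto. unfold Rminus; ring.
    - intros t Ht. assert (exp (alpha * (t - 1)) <= exp (x (t - 1))).
      { apply exp_le, wave_before_ge. lra. }
      pose proof (wave_alpha _ _ _ _ W). nra. }
  rewrite (wave_0 W) in H.
  replace (alpha * (1 - 1)) with 0 in H by ring. rewrite exp_0 in H.
  replace (alpha * (0 - 1)) with (- alpha) in H by ring. lra.
Qed.

(** The descent from the zero [q] to the minimum lasts exactly one delay, and the steepest possible
    slope belongs to the delayed value [x 1]. *)
Lemma wave_min_ge : - alpha * (exp (x 1) - 1) <= x (1 + q).
Proof.
  assert (H : - alpha * (exp (x 1) - 1) * ((1 + q) - q) <= x (1 + q) - x q).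
  { apply (is_derive_bound_below x (fun t => - alpha * (exp (x (t - 1)) - 1))); [lra | |].
    - intros; apply (wave_derive W).
    - intros t _. assert (exp (x (t - 1)) <= exp (x 1)) by (apply exp_le, (wave_range W)).
      pose proof (wave_alpha _ _ _ _ W). nra. }
  rewrite (wave_zq W) in H. lra.
Qed.

Lemma wave_ge (t : R) : - alpha * (exp alpha - 1) <= x t.
Proof.
  apply Rle_trans with (2 := proj1 (wave_range W t)).
  apply Rle_trans with (2 := wave_min_ge).
  assert (exp (x 1) <= exp alpha) by apply exp_le, wave_max_le_alpha.
  pose proof (wave_alpha _ _ _ _ W). nra.
Qed.

(** The climb from the minimum -m to the next zero takes time qb - 1, with slope at most alpha m
    because 1 + y <= e^y. Dividing by m leaves 1 <= alpha (qb - 1). *)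
Lemma wave_qb_ge : 1 + 1 / alpha <= qb.
Proof.
  pose proof (wave_alpha _ _ _ _ W) as Ha. pose proof (wave_qb _ _ _ _ W).
  set (m := - x (1 - qb)).
  assert (Hm : 0 < m).
  { unfold m. rewrite (wave_min_eq W). pose proof (wave_min_neg W). lra. }
  assert (H1 : x 0 - x (1 - qb) <= alpha * m * (0 - (1 - qb))).
  { apply (is_derive_bound_above x (fun t => - alpha * (exp (x (t - 1)) - 1))); [lra | |].
    - intros; apply (wave_derive W).
    - intros t _. assert (H1 := exp_ge_1_plus (x (t - 1))).
      assert (H2 := proj1 (wave_range W (t - 1))). rewrite <- (wave_min_eq W) in H2.
      unfold m. nra. }
  rewrite (wave_0 W) in H1.
  assert (H2 : 1 <= alpha * (qb - 1)).
  { apply (Rmult_le_reg_l m); [auto |]. unfold m in *. lra. }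
  apply (Rmult_le_reg_l alpha); [auto |].
  replace (alpha * (1 + 1 / alpha)) with (alpha + 1) by (field; lra). lra.
Qed.

(** Falling from the maximum M to 0 with slope at least -alpha (e^M - 1) takes time at least M /
    (alpha (e^M - 1)). This decreases in M, so the upper bound on M may be inserted. *)
Lemma wave_q_ge :
  1 + 1 / alpha * ((alpha + exp (- alpha) - 1) / (exp (alpha + exp (- alpha) - 1) - 1)) <= q.
Proof.
  pose proof (wave_alpha _ _ _ _ W) as Ha. pose proof (wave_q _ _ _ _ W).
  pose proof (wave_max_pos W) as HM. assert (HeM := exp_gt_1 _ HM).
  set (M2 := alpha + exp (- alpha) - 1).
  assert (H1 : - alpha * (exp (x 1) - 1) * (q - 1) <= x q - x 1).
  { apply (is_derive_bound_below x (fun t => - alpha * (exp (x (t - 1)) - 1))); [lra | |].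
    - intros; apply (wave_derive W).
    - intros t _. assert (exp (x (t - 1)) <= exp (x 1)) by (apply exp_le, (wave_range W)). nra. }
  rewrite (wave_zq W) in H1.
  assert (H2 : M2 / (exp M2 - 1) <= x 1 / (exp (x 1) - 1)).
  { apply div_exp_minus_1_antitone; auto. apply wave_max_le. }
  assert (H3 : 1 / alpha * (x 1 / (exp (x 1) - 1)) <= q - 1).
  { apply (Rmult_le_reg_l (alpha * (exp (x 1) - 1))); [apply Rmult_lt_0_compat; lra |].
    replace (alpha * (exp (x 1) - 1) * (1 / alpha * (x 1 / (exp (x 1) - 1)))) with (x 1)
      by (field; lra). lra. }
  assert (H4 : 1 / alpha * (M2 / (exp M2 - 1)) <= 1 / alpha * (x 1 / (exp (x 1) - 1))).
  { apply Rmult_le_compat_l; auto. apply Rlt_le, Rdiv_lt_0_compat; lra. }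
  lra.
Qed.

(** Otherwise the delayed value stays above [x 2] throughout [2, 2 + 1/alpha], where 1/alpha <= 1
    keeps the delayed times at most 2. The slope is then at most -alpha x(2), which brings x down to
    0 within time 1/alpha. *)
Lemma wave_q_le : 1 <= alpha -> q <= 2 + 1 / alpha.
Proof.
  intros Ha. destruct (Rle_lt_dec q (2 + 1 / alpha)) as [| H]; auto. exfalso.
  assert (H1 : 0 < 1 / alpha) by (apply Rdiv_lt_0_compat; lra).
  assert (H2 : 1 / alpha <= 1).
  { apply (Rmult_le_reg_l alpha); [lra |].
    replace (alpha * (1 / alpha)) with 1 by (field; lra). lra. }
  assert (H3 : x (2 + 1 / alpha) - x 2 <= - alpha * x 2 * ((2 + 1 / alpha) - 2)).
  { apply (is_derive_bound_above x (fun t => - alpha * (exp (x (t - 1)) - 1))); [lra | |].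
    - intros; apply (wave_derive W).
    - intros t Ht. assert (K1 := exp_ge_1_plus (x (t - 1))).
      assert (K2 : x 2 <= x (t - 1)) by (apply (wave_decreasing_le W); lra). nra. }
  replace (- alpha * x 2 * (2 + 1 / alpha - 2)) with (- x 2) in H3 by (field; lra).
  assert (0 < x (2 + 1 / alpha)) by (apply (wave_pos _ _ _ _ W); lra). lra.
Qed.

(* When -1 and -1/alpha lie on different branches of x, the equation bounds
   [|x (-t)|] by [alpha t (1 - exp (x (-1)))] for t <= 1/alpha, so that the level
   of x(-1) works if the level of x(-1/alpha) does not. *)
Lemma wave_separating_level :
  1 <= alpha ->
  exists c, 0 <= c /\
    (forall t, 0 <= t <= 1 / alpha -> 1 - exp (x (- t)) <= c) /\
    (forall t, 1 / alpha <= t <= 1 -> c <= 1 - exp (x (- t))).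
Proof.
  intros Ha.
  pose proof (wave_qb _ _ _ _ W) as Hqb. pose proof wave_qb_ge as Hqb'.
  assert (H1 : 0 < 1 / alpha) by (apply Rdiv_lt_0_compat; lra).
  assert (H2 : 1 / alpha <= 1).
  { apply (Rmult_le_reg_l alpha); [lra |].
    replace (alpha * (1 / alpha)) with 1 by (field; lra). lra. }
  assert (Hnear : forall t, 0 <= t <= 1 / alpha -> 1 - exp (x (- t)) <= 1 - exp (x (- (1 / alpha)))).
  { intros t Ht.
    assert (exp (x (- (1 / alpha))) <= exp (x (- t))) by (apply exp_le, (wave_increasing_le W); lra).
    lra. }
  assert (Hfar : forall t, 1 / alpha <= t <= 1 -> t <= qb - 1 ->
            1 - exp (x (- (1 / alpha))) <= 1 - exp (x (- t))).
  { intros t Ht Hqt.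
    assert (exp (x (- t)) <= exp (x (- (1 / alpha)))) by (apply exp_le, (wave_increasing_le W); lra).
    lra. }
  assert (Hpos : forall t, 0 < t <= 1 -> 0 <= 1 - exp (x (- t))).
  { intros t Ht. assert (exp (x (- t)) < 1) by (apply exp_lt_1, (wave_neg_before W); lra). lra. }
  assert (Hdec : forall s t, - qb <= s -> s <= t -> t <= 1 - qb -> x t <= x s).
  { intros s t Hs Hst Ht. rewrite <- (wave_per _ _ _ _ W s), <- (wave_per _ _ _ _ W t).
    pose proof (wave_q _ _ _ _ W). apply (wave_decreasing_le W); lra. }
  destruct (Rle_lt_dec (1 - exp (x (- (1 / alpha)))) (1 - exp (x (- (1))))) as [Hc | Hc].
  - exists (1 - exp (x (- (1 / alpha)))). split; [apply Hpos; lra |]. split; [exact Hnear |].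
    intros t Ht. destruct (Rle_lt_dec t (qb - 1)) as [Hq | Hq]; [now apply Hfar |].
    assert (exp (x (- t)) <= exp (x (- (1)))) by (apply exp_le, Hdec; lra). lra.
  - assert (Hqb2 : qb < 2).
    { destruct (Rlt_le_dec qb 2) as [| K]; auto. specialize (Hfar 1). lra. }
    exists (1 - exp (x (- (1)))). split; [apply Hpos; lra |]. split.
    + intros t Ht.
      assert (K : x 0 - x (- t) <= alpha * (1 - exp (x (- (1)))) * (0 - - t)).
      { apply (is_derive_bound_above x (fun t => - alpha * (exp (x (t - 1)) - 1))); [lra | |].
        - intros; apply (wave_derive W).
        - intros r Hr. assert (exp (x (- (1))) <= exp (x (r - 1))) by (apply exp_le, Hdec; lra). nra. }
      rewrite (wave_0 W) in K.
      assert (K1 := exp_ge_1_plus (x (- t))).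
      assert (K2 : alpha * t <= 1).
      { replace 1 with (alpha * (1 / alpha)) by (field; lra). apply Rmult_le_compat_l; lra. }
      assert (K3 := Hpos 1 ltac:(lra)). nra.
    + intros t Ht. destruct (Rle_lt_dec t (qb - 1)) as [Hq | Hq].
      * specialize (Hfar t Ht Hq). lra.
      * assert (exp (x (- t)) <= exp (x (- (1)))) by (apply exp_le, Hdec; lra). lra.
Qed.

(* Integrating [x(2) = x(1) - alpha * int_0^1 (exp x - 1)] by parts reduces
   [x(2) <= 0] to the positivity of the integral of
   [(alpha |t| - 1) (1 - exp x(t))] over [-1, 0]. *)
Lemma wave_q_le_2 : 2 <= alpha -> q <= 2.
Proof.
  intros Ha. destruct (Rle_lt_dec q 2) as [| Hq]; auto. exfalso.
  destruct wave_separating_level as [c [Hc [Hnear Hfar]]]; [lra |].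
  set (F := fun s => x (1 + s) - alpha * (1 - s) * x s - x 1 + x s).
  assert (HF : F 1 - F 0 <= alpha * c * ((1 - alpha) * 1 + alpha * (1 * 1) / 2)
                          - alpha * c * ((1 - alpha) * 0 + alpha * (0 * 0) / 2)).
  { apply (is_derive_compare F (fun s => alpha * c * ((1 - alpha) * s + alpha * (s * s) / 2))
      (fun s => - alpha * (exp (x s) - 1) + alpha * x s
                + (1 - alpha * (1 - s)) * (- alpha * (exp (x (s - 1)) - 1)))
      (fun s => alpha * c * (1 - alpha * (1 - s)))); [lra | | |].
    - intros s _.
      assert (D1 := wave_derive W (1 + s)). assert (D2 := wave_derive W s).
      replace (1 + s - 1) with s in D1 by ring.
      unfold F. auto_derive.
      + repeat split; eexists; [exact D1 | exact D2 | exact D2].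
      + rewrite (is_derive_unique (fun r : R => x r) _ _ D1), (is_derive_unique (fun r : R => x r) _ _ D2). ring.
    - intros s _. auto_derive; auto. field.
    - intros s Hs.
      assert (K1 := exp_ge_1_plus (x s)).
      (* The weight 1 - alpha (1 - s) changes sign at 1 - s = 1/alpha, exactly where [c] changes
         sides, so replacing the varying factor by [c] is correct on both parts. The weight has
         integral 1 - alpha/2 over [0,1], which is where alpha >= 2 enters; [F 1 - F 0] is [x 2]. *)
      assert (K2 : (1 - alpha * (1 - s)) * (1 - exp (x (- (1 - s)))) <= (1 - alpha * (1 - s)) * c).
      { assert (Hinv : alpha * (1 / alpha) = 1) by (field; lra).
        destruct (Rle_lt_dec (1 - s) (1 / alpha)) as [K | K].
        - apply Rmult_le_compat_l; [nra |]. apply Hnear. lra.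
        - assert (c <= 1 - exp (x (- (1 - s)))) by (apply Hfar; lra).
          assert (1 - alpha * (1 - s) <= 0) by nra. nra. }
      replace (- (1 - s)) with (s - 1) in K2 by ring. nra. }
  unfold F in HF. rewrite (wave_0 W) in HF.
  replace (1 + 1) with 2 in HF by ring. replace (1 + 0) with 1 in HF by ring.
  assert (0 < x 2) by (apply (wave_pos _ _ _ _ W); lra).
  assert (0 <= alpha * c * (alpha - 2)) by (apply Rmult_le_pos; [apply Rmult_le_pos |]; lra). lra.
Qed.

(** The induction closes because slopes at times r <= 1 only see values at times <= 0: a lower bound
    on x there gives an upper bound on the slope, hence both the next lower bound before 0 and the
    upper bound on [0,1]. The sign of p lets the solution's parameter be replaced by the larger
    [a]. *)
Lemma wave_p_iter_bounds (a : R) (n : nat) :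
  alpha <= a ->
  let p := Nat.iter n (fun p t => - a * RInt (fun s => exp (p (s - 1)) - 1) 0 t)
             (fun t => a * t) in
  (forall t, continuous p t) /\
  (forall t, t <= 0 -> p t <= x t /\ p t <= 0) /\
  (forall t, 0 <= t <= 1 -> x t <= p t).
Proof.
  intros Ha. pose proof (wave_alpha _ _ _ _ W) as Ha0.
  induction n as [| n [IHc [IHn IHp]]].
  - cbn. split; [| split].
    + intros t. apply (ex_derive_continuous (fun t : R => a * t)). auto_derive. auto.
    + intros t Ht. assert (H := wave_before_ge t Ht). split; nra.
    + intros t Ht. assert (H := wave_rise_le 0 t ltac:(lra)). rewrite (wave_0 W) in H. nra.
  - set (p := Nat.iter n _ _) in *. cbn -[Nat.iter]. change (Nat.iter (S n) _ _) with
      (fun t => - a * RInt (fun s => exp (p (s - 1)) - 1) 0 t). cbv zeta beta.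
    assert (Hc : forall t, continuous (fun s => exp (p (s - 1)) - 1) t).
    { intros t. apply (continuous_comp (fun s => p (s - 1)) (fun y => exp y - 1)).
      - apply (continuous_comp (fun s => s - 1) p); [| apply IHc].
        apply (ex_derive_continuous (fun s : R => s - 1)). auto_derive. auto.
      - apply (ex_derive_continuous (fun y : R => exp y - 1)). auto_derive. auto. }
    assert (Hd : forall t, is_derive (fun t => - a * RInt (fun s => exp (p (s - 1)) - 1) 0 t) t
                   (- a * (exp (p (t - 1)) - 1))).
    { intros t. apply (is_derive_scal (fun t => RInt (fun s => exp (p (s - 1)) - 1) 0 t) t (- a)).
      apply (is_derive_RInt_upper (fun s => exp (p (s - 1)) - 1) 0 t Hc). }
    assert (H0 : - a * RInt (fun s => exp (p (s - 1)) - 1) 0 0 = 0).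
    { rewrite RInt_point. unfold zero; simpl. ring. }
    assert (Hslope : forall r, r <= 1 -> - alpha * (exp (x (r - 1)) - 1) <= - a * (exp (p (r - 1)) - 1)
                        /\ 0 <= - a * (exp (p (r - 1)) - 1)).
    { intros r Hr. destruct (IHn (r - 1) ltac:(lra)) as [K1 K2].
      assert (exp (p (r - 1)) <= exp (x (r - 1))) by (apply exp_le; auto).
      apply exp_le in K2. rewrite exp_0 in K2. split; nra. }
    split; [| split].
    + intros t. eapply continuous_of_is_derive, Hd.
    + intros t Ht.
      assert (K1 : x 0 - x t <= - a * RInt (fun s => exp (p (s - 1)) - 1) 0 0
                     - - a * RInt (fun s => exp (p (s - 1)) - 1) 0 t).
      { apply (is_derive_compare x (fun t => - a * RInt (fun s => exp (p (s - 1)) - 1) 0 t)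
           (fun t => - alpha * (exp (x (t - 1)) - 1)) (fun t => - a * (exp (p (t - 1)) - 1))); auto.
        - intros; apply (wave_derive W).
        - intros r Hr. apply Hslope. lra. }
      rewrite H0, (wave_0 W) in K1. split; [lra |].
      apply Rle_trans with (- a * RInt (fun s => exp (p (s - 1)) - 1) 0 0); [| now rewrite H0; right].
      apply (is_derive_increasing (fun t => - a * RInt (fun s => exp (p (s - 1)) - 1) 0 t)
               (fun t => - a * (exp (p (t - 1)) - 1))); auto.
      intros r Hr. apply Hslope. lra.
    + intros t Ht.
      assert (K1 : x t - x 0 <= - a * RInt (fun s => exp (p (s - 1)) - 1) 0 t
                     - - a * RInt (fun s => exp (p (s - 1)) - 1) 0 0).
      { apply (is_derive_compare x (fun t => - a * RInt (fun s => exp (p (s - 1)) - 1) 0 t)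
           (fun t => - alpha * (exp (x (t - 1)) - 1)) (fun t => - a * (exp (p (t - 1)) - 1))); [lra | | auto |].
        - intros; apply (wave_derive W).
        - intros r Hr. apply Hslope. lra. }
      rewrite H0, (wave_0 W) in K1. lra.
Qed.

(** For qb >= 3 the rising branch contains [-2, -1], so the slope decreases on [-1, 0] and x lies
    below its tangent at 0. *)
Lemma wave_concave_tangent (t : R) :
  3 <= qb -> -1 <= t <= 0 -> x t <= - t * (alpha * (exp (x (-1)) - 1)).
Proof.
  intros Hqb Ht. pose proof (wave_alpha _ _ _ _ W) as Ha0.
  assert (H : - alpha * (exp (x (-1)) - 1) * (0 - t) <= x 0 - x t).
  { apply (is_derive_bound_below x (fun t => - alpha * (exp (x (t - 1)) - 1))); [lra | |].
    - intros; apply (wave_derive W).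
    - intros r Hr. assert (exp (x (r - 1)) <= exp (x (-1))) by (apply exp_le, (wave_increasing_le W); lra).
      nra. }
  rewrite (wave_0 W) in H. lra.
Qed.

(** The tangent at time -1 gives x(-1) <= alpha (e^{x(-1)} - 1), and this map is monotone, so each
    bound yields the next. For the first one put y = -x(-1): if alpha > 1 + y, then alpha (1 -
    e^(-y)) > y by e^y > 1 + y, a contradiction. *)
Lemma wave_minus_1_le_a_iter (n : nat) :
  3 <= qb -> x (-1) <= Nat.iter n (fun a => alpha * (exp a - 1)) (- (alpha - 1)).
Proof.
  intros Hqb. pose proof (wave_alpha _ _ _ _ W) as Ha0.
  assert (H := wave_concave_tangent (-1) Hqb ltac:(lra)).
  induction n as [| n IH].
  - simpl. set (y := - x (-1)).
    assert (Hy : 0 < y) by (pose proof (wave_neg_before W (-1)); unfold y; lra).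
    destruct (Rle_lt_dec (alpha - 1) y) as [| K]; [unfold y in *; lra |]. exfalso.
    assert (K1 : y * exp (- y) >= alpha * exp (- y) * (1 - exp (- y))).
    { apply Rle_ge. assert (alpha * (1 - exp (- y)) <= y).
      { unfold y at 1. rewrite Ropp_involutive. unfold y. lra. }
      pose proof (exp_pos (- y)). nra. }
    assert (K2 := exp_ineq1 y ltac:(lra)).
    assert (K3 : exp y * exp (- y) = 1) by (rewrite <- exp_plus, Rplus_opp_r; apply exp_0).
    pose proof (exp_pos (- y)).
    assert (K4 : alpha * (1 - exp (- y)) <= y) by (apply (Rmult_le_reg_l (exp (- y))); lra).
    assert (K5 : (1 + y) * (1 - exp (- y)) > y) by nra.
    assert (exp (- y) < 1) by (apply exp_lt_1; lra). nra.
  - simpl. assert (exp (x (-1)) <= exp (Nat.iter n (fun a => alpha * (exp a - 1)) (- (alpha - 1)))).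
    { now apply exp_le. }
    nra.
Qed.

(** A later iterate bounds the tangent slope through the bound of its predecessor on x(-1). The
    first iterate has no predecessor; it works because alpha e^(-(alpha-1)) <= 1 makes it dominate
    the second. *)
Lemma wave_le_a_iter (n : nat) (t : R) :
  3 <= qb -> -1 <= t <= 0 ->
  x t <= - t * Nat.iter n (fun a => alpha * (exp a - 1)) (- (alpha - 1)).
Proof.
  intros Hqb Ht. pose proof (wave_alpha _ _ _ _ W) as Ha0.
  apply Rle_trans with (1 := wave_concave_tangent t Hqb Ht).
  apply Rmult_le_compat_l; [lra |].
  destruct n as [| n].
  - simpl. assert (H := wave_minus_1_le_a_iter 0 Hqb). simpl in H.
    assert (H1 : exp (x (-1)) <= exp (- (alpha - 1))) by now apply exp_le.
    assert (H2 := exp_ge_1_plus (alpha - 1)).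
    assert (H3 : exp (alpha - 1) * exp (- (alpha - 1)) = 1)
      by (rewrite <- exp_plus, Rplus_opp_r; apply exp_0).
    pose proof (exp_pos (- (alpha - 1))). nra.
  - simpl. apply Rmult_le_compat_l; [lra |].
    assert (exp (x (-1)) <= exp (Nat.iter n (fun a => alpha * (exp a - 1)) (- (alpha - 1)))).
    { apply exp_le. now apply wave_minus_1_le_a_iter. }
    lra.
Qed.

(** On [q + 2, q + qb] the delayed values lie, one period earlier, on the rising branch up to time
    -1, so the slope is at least alpha (1 - e^a). The climb to 0 starts no lower than the global
    lower bound, and alpha cancels. *)
Lemma wave_qb_le (a : R) :
  3 <= qb -> x (-1) <= a -> a < 0 -> qb <= 2 + (exp alpha - 1) / (1 - exp a).
Proof.
  intros Hqb Hxa Ha. pose proof (wave_alpha _ _ _ _ W) as Ha0.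
  pose proof (wave_q _ _ _ _ W) as Hq.
  assert (He := exp_lt_1 a Ha).
  assert (H1 : alpha * (1 - exp a) * ((q + qb - 0) - (q + 2)) <= x (q + qb - 0) - x (q + 2)).
  { apply (is_derive_bound_below x (fun t => - alpha * (exp (x (t - 1)) - 1))); [lra | |].
    - intros; apply (wave_derive W).
    - intros r Hr.
      assert (K : x (r - 1) <= a).
      { apply Rle_trans with (2 := Hxa).
        rewrite <- (wave_per_sub W (r - 1)). apply (wave_increasing_le W); lra. }
      apply exp_le in K. nra. }
  rewrite Rminus_0_r, (wave_zL W) in H1.
  assert (H2 : - alpha * (exp alpha - 1) <= x (q + 2)) by apply wave_ge.
  assert (H3 : (qb - 2) * (1 - exp a) <= exp alpha - 1) by nra.
  apply (Rmult_le_reg_r (1 - exp a)); [lra |].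
  replace ((2 + (exp alpha - 1) / (1 - exp a)) * (1 - exp a)) with (2 * (1 - exp a) + (exp alpha - 1))
    by (field; lra). lra.
Qed.

End Estimates.

(** * A lower bound on the amplitude *)

(** A pointwise inverse function rule, meant for x(r(s)) = x(s) with [r] only known to be
    continuous. If k is the increment of [s], then d k and e h both approximate the increment of the
    composite, up to small multiples of |k| and |h|. As d is nonzero the |k| error is absorbed, so
    |k| = O(|h|) and k/h tends to e/d. *)
Lemma derivable_pt_lim_of_comp (F s : R -> R) (r0 d e : R) :
  d <> 0 -> continuity_pt s r0 -> derivable_pt_lim F (s r0) d ->
  derivable_pt_lim (fun r => F (s r)) r0 e -> derivable_pt_lim s r0 (e / d).
Proof.
  intros Hd Hc HF Hcomp eps Heps.
  assert (Hd' : 0 < Rabs d) by now apply Rabs_pos_lt.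
  assert (He' := Rabs_pos e).
  (* [C] will bound (|k| + |h|) / |h|. In [eta], the bound |d|/2 absorbs the |k| term, the bound 1
     replaces |e| + eta by |e| + 1, and the last one makes the final error less than eps. *)
  set (C := 2 * (Rabs e + 1) / Rabs d + 1).
  assert (HC : 0 < C).
  { unfold C. assert (0 < 2 * (Rabs e + 1) / Rabs d) by (apply Rdiv_lt_0_compat; lra). lra. }
  set (eta := Rmin (Rmin (Rabs d / 2) 1) (eps * Rabs d / (2 * C))).
  assert (Heta : 0 < eta).
  { unfold eta. repeat apply Rmin_pos; try lra.
    apply Rdiv_lt_0_compat; [apply Rmult_lt_0_compat |]; lra. }
  assert (Heta1 : eta <= Rabs d / 2).
  { unfold eta. eapply Rle_trans; [apply Rmin_l | apply Rmin_l]. }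
  assert (Heta2 : eta <= 1).
  { unfold eta. eapply Rle_trans; [apply Rmin_l | apply Rmin_r]. }
  assert (Heta3 : eta * C <= eps * Rabs d / 2).
  { apply (Rmult_le_reg_r (/ C)); [now apply Rinv_0_lt_compat |].
    replace (eta * C * / C) with eta by (field; lra).
    replace (eps * Rabs d / 2 * / C) with (eps * Rabs d / (2 * C)) by (field; lra).
    apply Rmin_r. }
  destruct (HF eta Heta) as [d1 HF'].
  destruct (Hcomp eta Heta) as [d2 Hcomp'].
  destruct (Hc d1 (cond_pos d1)) as [d3 [Hd3 Hc']].
  assert (Hmin : 0 < Rmin d2 d3) by (apply Rmin_pos; [apply cond_pos | exact Hd3]).
  exists (mkposreal _ Hmin). intros h Hh0 Hh. simpl in Hh.
  assert (Hh2 : Rabs h < d2) by (eapply Rlt_le_trans; [exact Hh | apply Rmin_l]).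
  assert (Hh3 : Rabs h < d3) by (eapply Rlt_le_trans; [exact Hh | apply Rmin_r]).
  assert (Hh' : 0 < Rabs h) by now apply Rabs_pos_lt.
  set (k := s (r0 + h) - s r0).
  assert (Hk : Rabs k < d1).
  { unfold k. apply (Hc' (r0 + h)). split.
    - split; [exact I |]. lra.
    - simpl. unfold Rdist. now replace (r0 + h - r0) with h by ring. }
  assert (E1 : Rabs (F (s (r0 + h)) - F (s r0) - d * k) <= eta * Rabs k).
  { destruct (Req_dec k 0) as [K | K].
    - rewrite K. assert (K' : s (r0 + h) = s r0) by (unfold k in K; lra).
      rewrite K'. rewrite Rmult_0_r, Rminus_0_r, Rminus_diag, Rabs_R0. lra.
    - specialize (HF' k K Hk). replace (s r0 + k) with (s (r0 + h)) in HF' by (unfold k; ring).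
      replace (F (s (r0 + h)) - F (s r0) - d * k)
        with (((F (s (r0 + h)) - F (s r0)) / k - d) * k) by (field; auto).
      rewrite Rabs_mult. apply Rmult_le_compat_r; [apply Rabs_pos | lra]. }
  assert (E2 : Rabs (F (s (r0 + h)) - F (s r0) - e * h) <= eta * Rabs h).
  { specialize (Hcomp' h Hh0 Hh2).
    replace (F (s (r0 + h)) - F (s r0) - e * h)
      with (((F (s (r0 + h)) - F (s r0)) / h - e) * h) by (field; auto).
    rewrite Rabs_mult. apply Rmult_le_compat_r; [apply Rabs_pos | lra]. }
  assert (E3 : Rabs (d * k - e * h) <= eta * Rabs k + eta * Rabs h).
  { replace (d * k - e * h) with ((F (s (r0 + h)) - F (s r0) - e * h)
        - (F (s (r0 + h)) - F (s r0) - d * k)) by ring.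
    eapply Rle_trans; [apply Rabs_triang |]. rewrite Rabs_Ropp. lra. }
  assert (E4 : Rabs d * Rabs k <= 2 * (Rabs e + 1) * Rabs h).
  { assert (T : Rabs (d * k) <= Rabs (d * k - e * h) + Rabs (e * h)).
    { replace (d * k) with ((d * k - e * h) + e * h) at 1 by ring. apply Rabs_triang. }
    rewrite (Rabs_mult d k), (Rabs_mult e h) in T.
    assert (Hk0 := Rabs_pos k). nra. }
  assert (E5 : Rabs k <= 2 * (Rabs e + 1) / Rabs d * Rabs h).
  { apply (Rmult_le_reg_l (Rabs d)); auto.
    replace (Rabs d * (2 * (Rabs e + 1) / Rabs d * Rabs h)) with (2 * (Rabs e + 1) * Rabs h)
      by (field; lra). exact E4. }
  assert (E6 : Rabs (d * k - e * h) <= eta * C * Rabs h).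
  { apply Rle_trans with (1 := E3). unfold C.
    replace (eta * (2 * (Rabs e + 1) / Rabs d + 1) * Rabs h)
      with (eta * (2 * (Rabs e + 1) / Rabs d * Rabs h) + eta * Rabs h) by ring.
    apply Rplus_le_compat_r, Rmult_le_compat_l; lra. }
  fold k. replace (k / h - e / d) with ((d * k - e * h) / (d * h)) by (field; auto).
  unfold Rdiv. rewrite Rabs_mult, Rabs_inv, Rabs_mult.
  apply (Rmult_lt_reg_r (Rabs d * Rabs h)); [now apply Rmult_lt_0_compat |].
  rewrite Rmult_assoc, Rinv_l, Rmult_1_r
    by (apply Rgt_not_eq, Rmult_lt_0_compat; auto).
  apply Rle_lt_trans with (1 := E6).
  apply Rle_lt_trans with (eps * Rabs d / 2 * Rabs h);
    [apply Rmult_le_compat_r; lra |].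
  assert (0 < eps * Rabs d * Rabs h) by (repeat apply Rmult_lt_0_compat; lra). lra.
Qed.

(** * Integrals of continuous functions: shifts, periods and parameters *)

Lemma continuous_mult_R (f g : R -> R) (t : R) :
  continuous f t -> continuous g t -> continuous (fun s => f s * g s) t.
Proof. intros Hf Hg. apply (continuous_mult (K := R_AbsRing) f g); auto. Qed.

Lemma continuous_comp_shift (f : R -> R) (u t : R) :
  continuous f (t - u) -> continuous (fun s => f (s - u)) t.
Proof.
  intros Hf. apply (continuous_comp (fun s => s - u) f); auto.
  apply (ex_derive_continuous (fun s : R => s - u)). auto_derive. auto.
Qed.

Lemma RInt_Chasles_sub (f : R -> R) (c a b : R) :
  (forall t, continuous f t) -> RInt f a b = RInt f c b - RInt f c a.
Proof.
  intros Hf.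
  assert (H := RInt_Chasles f c a b (ex_RInt_continuous_R _ _ _ Hf) (ex_RInt_continuous_R _ _ _ Hf)).
  unfold plus in H; simpl in H. lra.
Qed.

Lemma RInt_periodic (f : R -> R) (L a b : R) :
  (forall t, continuous f t) -> (forall t, f (t + L) = f t) ->
  RInt f a (a + L) = RInt f b (b + L).
Proof.
  intros Hf Hper.
  assert (Hd : forall c, is_derive (fun c => RInt f 0 (c + L) - RInt f 0 c) c (1 * f (c + L) - f c)).
  { intros c. apply (is_derive_minus (fun c => RInt f 0 (c + L)) (fun c => RInt f 0 c)).
    - apply (is_derive_comp (RInt f 0) (fun c => c + L) c).
      + now apply is_derive_RInt_upper.
      + auto_derive; auto.
    - now apply is_derive_RInt_upper. }
  rewrite (RInt_Chasles_sub f 0 a (a + L) Hf), (RInt_Chasles_sub f 0 b (b + L) Hf).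
  destruct (MVT_gen (fun c => RInt f 0 (c + L) - RInt f 0 c) a b
    (fun c => 1 * f (c + L) - f c)) as [c [_ Hc]].
  - intros; apply Hd.
  - intros c _. apply continuity_pt_filterlim. exact (continuous_of_is_derive _ _ _ (Hd c)).
  - rewrite Hper in Hc. lra.
Qed.

Lemma RInt_shift (f : R -> R) (v a b : R) :
  (forall t, continuous f t) -> RInt (fun s => f (s + v)) a b = RInt f (a + v) (b + v).
Proof.
  intros Hf.
  assert (H := RInt_comp_lin f 1 v a b (ex_RInt_continuous_R _ _ _ Hf)).
  rewrite !Rmult_1_l in H. rewrite <- H. apply RInt_ext. intros s _.
  unfold scal; simpl. unfold mult; simpl. now rewrite !Rmult_1_l.
Qed.

Lemma is_derive_RInt_shift (f df k : R -> R) (a b u : R) :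
  (forall t, is_derive f t (df t)) -> (forall t, continuous df t) ->
  (forall t, continuous k t) ->
  is_derive (fun u => RInt (fun s => f (s - u) * k s) a b) u
    (RInt (fun s => - df (s - u) * k s) a b).
Proof.
  intros Hf Hdf Hk.
  assert (Hd : forall v t, is_derive (fun z : R => f (t - z) * k t) v (- df (t - v) * k t)).
  { intros v t. assert (D := Hf (t - v)). auto_derive; [now exists (df (t - v)) |].
    replace (t + - v) with (t - v) by ring.
    rewrite (is_derive_unique (fun r : R => f r) _ _ D). ring. }
  rewrite (RInt_ext (fun s => - df (s - u) * k s) (fun s => Derive (fun z => f (s - z) * k s) u)).
  2: { intros s _. symmetry. apply is_derive_unique, Hd. }
  apply (is_derive_RInt_param (fun u s => f (s - u) * k s)).
  - apply filter_forall. intros v t _. now exists (- df (t - v) * k t).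
  - intros t _.
    apply (continuity_2d_pt_ext (fun u v => - df (v - u) * k v)).
    { intros v r. symmetry. apply is_derive_unique, Hd. }
    apply continuity_2d_pt_mult.
    + apply continuity_2d_pt_opp.
      apply (continuity_1d_2d_pt_comp df (fun u v => v - u)).
      * apply continuity_pt_filterlim, Hdf.
      * apply continuity_2d_pt_minus; [apply continuity_2d_pt_id2 | apply continuity_2d_pt_id1].
    + apply (continuity_1d_2d_pt_comp k (fun u v => v)).
      * apply continuity_pt_filterlim, Hk.
      * apply continuity_2d_pt_id2.
  - apply filter_forall. intros v. apply ex_RInt_continuous_R. intros t.
    apply continuous_mult_R; auto. apply continuous_comp_shift.
    eapply continuous_of_is_derive, Hf.
Qed.

Section Amplitude.
Context {alpha : R} {x : R -> R} {q qb : R} (W : wave alpha x q qb).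
Context (Hslope : forall t, PI / 2 <= alpha * exp (x t)).

Let xd := fun t : R => - alpha * (exp (x (t - 1)) - 1).
Let g := fun y : R => alpha * (exp y - 1) - PI / 2 * y.

Lemma excess_nondecreasing (y z : R) : PI / 2 <= alpha * exp y -> y <= z -> g y <= g z.
Proof.
  intros Hy Hyz. unfold g.
  assert (H1 := exp_ge_1_plus (z - y)).
  assert (H2 : exp z = exp y * exp (z - y)) by (rewrite <- exp_plus; f_equal; ring).
  assert (H3 : exp y * (z - y) <= exp z - exp y) by (pose proof (exp_pos y); nra).
  pose proof (wave_alpha _ _ _ _ W). nra.
Qed.

(** At equal levels, going back by at most one delay leads higher from the falling branch than from
    the rising one. If [t - u] is still falling, going back raises x at [t] and lowers it at [s],
    unless [s - u] passes the previous minimum; then both points lie on falling branches and are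
    compared after a period shift. Otherwise either 0 separates the two values or both points lie on
    the same rising branch. *)
Lemma wave_delayed_branches (u s t : R) :
  0 <= u <= 1 -> 1 - qb <= s <= 1 -> 1 <= t <= 1 + q -> x s = x t -> x (s - u) <= x (t - u).
Proof.
  intros Hu Hs Ht E.
  pose proof (wave_q _ _ _ _ W) as Hq. pose proof (wave_qb _ _ _ _ W) as Hqb.
  destruct (Rle_lt_dec 1 (t - u)) as [H1 | H1].
  - destruct (Rle_lt_dec (1 - qb) (s - u)) as [H2 | H2].
    + apply Rle_trans with (x s); [apply (wave_increasing_le W); lra |].
      rewrite E. apply (wave_decreasing_le W); lra.
    + rewrite <- (wave_per _ _ _ _ W (s - u)). apply (wave_decreasing_le W); lra.
  - destruct (Rle_lt_dec (s - u) 0) as [H2 | H2].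
    + apply Rle_trans with 0.
      * apply (wave_nonpos_before W); lra.
      * apply (wave_nonneg W); lra.
    + apply (wave_increasing_le W); lra.
Qed.

(** [r s] is the time on the falling branch at the level of [x s]. Strict monotonicity of that
    branch gives continuity: a strict inequality between [x s] and x at a time shifted by eps
    persists for nearby s. *)
Lemma wave_falling_branch_inverse :
  exists r : R -> R, (forall s, 1 <= r s <= 1 + q /\ x (r s) = x s) /\
    (forall s, continuous r s).
Proof.
  pose proof (wave_q _ _ _ _ W) as Hq. pose proof (wave_qb _ _ _ _ W) as Hqb.
  assert (Hex : forall s, {t | 1 <= t <= 1 + q /\ x t = x s}).
  { intros s. destruct (IVT_gen x 1 (1 + q) (x s)) as [t [Ht1 Ht2]].
    - intros t. apply continuity_pt_filterlim, (wave_continuous W).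
    - assert (x (1 + q) <= x 1) by apply (wave_range W).
      rewrite Rmin_right, Rmax_left by auto. apply (wave_range W).
    - exists t. rewrite Rmin_left, Rmax_right in Ht1 by lra. auto. }
  set (r := fun s => proj1_sig (Hex s)).
  assert (Hr : forall s, 1 <= r s <= 1 + q /\ x (r s) = x s).
  { intros s. unfold r. now destruct (Hex s). }
  exists r. split; auto.
  intros s0. destruct (Hr s0) as [Hr0 E0].
  assert (Hup : forall eps, 0 < eps -> locally s0 (fun s => r s < r s0 + eps)).
  { intros eps Heps. destruct (Rle_lt_dec (r s0 + eps) (1 + q)) as [H | H].
    - assert (Hlt : x (r s0 + eps) < x s0).
      { rewrite <- E0. apply (wave_decreasing W); lra. }
      destruct (continuous_pos_locally (fun s => x s - x (r s0 + eps)) s0) as [d [Hd1 Hd2]].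
      + apply (continuous_minus x (fun _ => x (r s0 + eps))).
        * apply (wave_continuous W).
        * apply continuous_const.
      + lra.
      + exists (mkposreal d Hd1). intros s Hs. apply Rnot_le_lt. intros Hle.
        assert (K : 0 < x s - x (r s0 + eps)).
        { apply Hd2. apply Rabs_def2 in Hs.
          unfold abs, minus, plus, opp in Hs; simpl in Hs. lra. }
        destruct (Hr s) as [Hrs Es]. rewrite <- Es in K.
        assert (x (r s) <= x (r s0 + eps)) by (apply (wave_decreasing_le W); lra). lra.
    - apply filter_forall. intros s. destruct (Hr s). lra. }
  assert (Hlo : forall eps, 0 < eps -> locally s0 (fun s => r s0 - eps < r s)).
  { intros eps Heps. destruct (Rle_lt_dec 1 (r s0 - eps)) as [H | H].
    - assert (Hlt : x s0 < x (r s0 - eps)).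
      { rewrite <- E0. apply (wave_decreasing W); lra. }
      destruct (continuous_pos_locally (fun s => x (r s0 - eps) - x s) s0) as [d [Hd1 Hd2]].
      + apply (continuous_minus (fun _ => x (r s0 - eps)) x).
        * apply continuous_const.
        * apply (wave_continuous W).
      + lra.
      + exists (mkposreal d Hd1). intros s Hs. apply Rnot_le_lt. intros Hle.
        assert (K : 0 < x (r s0 - eps) - x s).
        { apply Hd2. apply Rabs_def2 in Hs.
          unfold abs, minus, plus, opp in Hs; simpl in Hs. lra. }
        destruct (Hr s) as [Hrs Es]. rewrite <- Es in K.
        assert (x (r s0 - eps) <= x (r s)) by (apply (wave_decreasing_le W); lra). lra.
    - apply filter_forall. intros s. destruct (Hr s). lra. }
  apply filterlim_locally. intros eps.
  generalize (filter_and _ _ (Hup eps (cond_pos eps)) (Hlo eps (cond_pos eps))).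
  apply filter_imp. intros s [H1 H2].
  apply Rabs_def1; unfold minus, plus, opp; simpl; lra.
Qed.

Lemma wave_slope_continuous (t : R) : continuous xd t.
Proof.
  unfold xd. apply (continuous_comp_shift (fun s => - alpha * (exp (x s) - 1)) 1).
  apply (continuous_comp x (fun y => - alpha * (exp y - 1))); [apply (wave_continuous W) |].
  apply (ex_derive_continuous (fun y : R => - alpha * (exp y - 1))). auto_derive. auto.
Qed.

Lemma wave_slope_periodic (t : R) : xd (t + (q + qb)) = xd t.
Proof.
  unfold xd. replace (t + (q + qb) - 1) with (t - 1 + (q + qb)) by ring.
  now rewrite (wave_per _ _ _ _ W).
Qed.

Lemma excess_continuous (u t : R) : continuous (fun s => g (x (s - u))) t.
Proof.
  apply (continuous_comp_shift (fun s => g (x s)) u).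
  apply (continuous_comp x g); [apply (wave_continuous W) |].
  apply (ex_derive_continuous g). unfold g. auto_derive. auto.
Qed.

Let a := 1 - qb.
Let b := 1 + q.
Let A := fun u : R => RInt (fun s => x (s - u) * xd s) a b.
Let B := fun u : R => RInt (fun s => xd (s - u) * xd s) a b.
Let J := fun u : R => RInt (fun s => g (x (s - u)) * xd s) a b.

(* Substituting the level [c = x s] on the rising and on the falling branch
   turns [J u] into an integral over levels of [g (x (s - u)) - g (x (t - u))]
   where [x s = x t = c]. *)
Lemma excess_correlation_nonpos (u : R) : 0 <= u <= 1 -> J u <= 0.
Proof.
  intros Hu. pose proof (wave_q _ _ _ _ W) as Hq. pose proof (wave_qb _ _ _ _ W) as Hqb.
  destruct wave_falling_branch_inverse as [r [Hr Hrc]].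
  set (phi := fun s => g (x (s - u)) * xd s).
  assert (Hphi : forall t, continuous phi t).
  { intros t. apply continuous_mult_R; [apply excess_continuous | apply wave_slope_continuous]. }
  (* [H s] is the integral of [phi] from [s] to its partner [r s]: it is [J u] at [a] and 0 at 1.
     Its derivative is the rising slope times the nonnegative difference of g at the delayed
     partners, so [H] does not decrease. *)
  set (H := fun s => RInt phi 1 (r s) - RInt phi 1 s).
  assert (Hrinj : forall s t, 1 <= t <= 1 + q -> x t = x s -> r s = t).
  { intros s t Ht E. destruct (Hr s) as [Hrs Es].
    destruct (Rtotal_order (r s) t) as [K | [K | K]]; auto; exfalso.
    - assert (x t < x (r s)) by (apply (wave_decreasing W); lra). lra.
    - assert (x (r s) < x t) by (apply (wave_decreasing W); lra). lra. }
  (* At the ends the partner is an extremum, where [xd] vanishes and the formula for the derivative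
     of [r] breaks down; the mean value theorem only asks for continuity there. *)
  assert (HcH : forall s, continuity_pt H s).
  { intros s. apply continuity_pt_filterlim.
    apply (continuous_minus (fun s => RInt phi 1 (r s)) (fun s => RInt phi 1 s)).
    - apply (continuous_comp r (RInt phi 1)); [apply Hrc |].
      eapply continuous_of_is_derive, is_derive_RInt_upper, Hphi.
    - eapply continuous_of_is_derive, is_derive_RInt_upper, Hphi. }
  assert (HdH : forall s, 1 - qb < s < 1 ->
            is_derive H s (xd s * (g (x (r s - u)) - g (x (s - u))))).
  { intros s Hs. destruct (Hr s) as [Hrs Es].
    assert (Hr1 : 1 < r s < 1 + q).
    { assert (x s < x 1) by (apply (wave_increasing W); lra).
      assert (x (1 + q) < x s) by (rewrite <- (wave_min_eq W); apply (wave_increasing W); lra).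
      split.
      - destruct Hrs as [[K | K] _]; auto. rewrite <- K in Es. lra.
      - destruct Hrs as [_ [K | K]]; auto. rewrite K in Es. lra. }
    assert (Hxd : xd (r s) < 0).
    { unfold xd. assert (Hp : 0 < x (r s - 1)) by (apply (wave_pos _ _ _ _ W); lra).
      apply exp_gt_1 in Hp. pose proof (wave_alpha _ _ _ _ W). nra. }
    assert (Dr : is_derive r s (xd s / xd (r s))).
    { apply is_derive_Reals. apply (derivable_pt_lim_of_comp x).
      - lra.
      - apply continuity_pt_filterlim, Hrc.
      - apply is_derive_Reals, (wave_derive W).
      - apply is_derive_Reals. apply (is_derive_ext x).
        + intros t. symmetry. apply Hr.
        + apply (wave_derive W). }
    replace (xd s * (g (x (r s - u)) - g (x (s - u))))
      with (xd s / xd (r s) * phi (r s) - phi s) by (unfold phi; field; lra).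
    apply (is_derive_minus (fun s => RInt phi 1 (r s)) (fun s => RInt phi 1 s)).
    - apply (is_derive_comp (RInt phi 1) r); auto. now apply is_derive_RInt_upper.
    - now apply is_derive_RInt_upper. }
  destruct (MVT_gen H a 1 (fun s => xd s * (g (x (r s - u)) - g (x (s - u))))) as [c [Hc1 Hc2]].
  - unfold a. rewrite Rmin_left, Rmax_right by lra. exact HdH.
  - intros; apply HcH.
  - unfold a in *. rewrite Rmin_left, Rmax_right in Hc1 by lra.
    assert (K1 : 0 <= xd c).
    { unfold xd. assert (K : x (c - 1) <= 0) by (apply (wave_nonpos_before W); lra).
      apply exp_le in K. rewrite exp_0 in K. pose proof (wave_alpha _ _ _ _ W). nra. }
    assert (K2 : g (x (c - u)) <= g (x (r c - u))).
    { apply excess_nondecreasing; [apply Hslope |].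
      destruct (Hr c). apply wave_delayed_branches; auto. }
    assert (K3 : H a <= H 1).
    { unfold a. assert (0 <= xd c * (g (x (r c - u)) - g (x (c - u)))) by (apply Rmult_le_pos; lra).
      nra. }
    unfold H in K3.
    rewrite (Hrinj 1 1) in K3 by (auto; lra).
    rewrite (Hrinj a (1 + q)) in K3 by (try (unfold a; rewrite (wave_min_eq W); reflexivity); lra).
    unfold J. fold phi. rewrite (RInt_Chasles_sub phi 1) by apply Hphi.
    unfold a, b in *. lra.
Qed.

(** At delay one, x'(s) = -f(y) with y = x(s-1), so the integrand is -f(y) g(y), and both factors
    have the sign of y. For g this uses alpha > pi/2 when y > 0 and alpha e^y >= pi/2 when y < 0.
    The integral is split at s = 1, where y = 0. *)
Lemma excess_correlation_1_neg : J 1 < 0.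
Proof.
  pose proof (wave_q _ _ _ _ W) as Hq. pose proof (wave_qb _ _ _ _ W) as Hqb.
  pose proof (wave_alpha _ _ _ _ W) as Ha.
  set (F := fun s : R => - (g (x (s - 1)) * xd s)).
  assert (Hc : forall t, continuous F t).
  { intros t. apply (continuous_opp (fun s => g (x (s - 1)) * xd s)).
    apply continuous_mult_R; [apply excess_continuous | apply wave_slope_continuous]. }
  assert (Hlin : PI / 2 < alpha).
  { assert (H := Hslope (1 + q)). assert (K := exp_lt_1 _ (wave_min_neg W)). nra. }
  assert (Hpos : forall s, x (s - 1) <> 0 -> 0 < F s).
  { intros s Hs. unfold F, xd.
    replace (- (g (x (s - 1)) * (- alpha * (exp (x (s - 1)) - 1))))
      with (g (x (s - 1)) * (alpha * (exp (x (s - 1)) - 1))) by ring.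
    set (y := x (s - 1)) in *.
    destruct (Rtotal_order y 0) as [K | [K | K]]; [| contradiction |].
    - assert (K1 := exp_lt_1 y K).
      assert (K2 := exp_ineq1 (- y) ltac:(lra)).
      assert (K3 : exp y * exp (- y) = 1) by (rewrite <- exp_plus, Rplus_opp_r; apply exp_0).
      assert (K4 := Hslope (s - 1)). fold y in K4.
      pose proof (exp_pos y).
      assert (K5 : exp y * - y < 1 - exp y) by nra.
      assert (K6 : alpha * (exp y * - y) < alpha * (1 - exp y)) by (apply Rmult_lt_compat_l; auto).
      assert (K7 : PI / 2 * - y <= alpha * exp y * - y) by (apply Rmult_le_compat_r; lra).
      assert (g y < 0) by (unfold g; lra).
      assert (alpha * (exp y - 1) < 0) by nra. nra.
    - assert (K1 := exp_gt_1 y K). assert (K2 := exp_ge_1_plus y).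
      assert (K3 : PI / 2 * y < alpha * y) by (apply Rmult_lt_compat_r; lra).
      assert (K4 : alpha * y <= alpha * (exp y - 1)) by (apply Rmult_le_compat_l; lra).
      apply Rmult_lt_0_compat; [unfold g; lra | apply Rmult_lt_0_compat; lra]. }
  assert (H1 : 0 < RInt F a 1).
  { apply RInt_gt_0; [unfold a; lra | | auto].
    intros s Hs. apply Hpos. unfold a in Hs.
    assert (x (s - 1) < 0) by (apply (wave_neg_before W); lra). lra. }
  assert (H2 : 0 < RInt F 1 b).
  { apply RInt_gt_0; [unfold b; lra | | auto].
    intros s Hs. apply Hpos. unfold b in Hs.
    assert (0 < x (s - 1)) by (apply (wave_pos _ _ _ _ W); lra). lra. }
  assert (H3 : RInt F a b = - J 1).
  { unfold J. apply (RInt_opp (V := R_CompleteNormedModule) (fun s => g (x (s - 1)) * xd s)).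
    apply ex_RInt_continuous_R. intros t.
    apply continuous_mult_R; [apply excess_continuous | apply wave_slope_continuous]. }
  assert (H4 := RInt_Chasles_sub F a 1 b Hc).
  lra.
Qed.

Lemma correlation_derive (u : R) : is_derive A u (- B u).
Proof.
  replace (- B u) with (RInt (fun s => - xd (s - u) * xd s) a b).
  - apply is_derive_RInt_shift; intros; [apply (wave_derive W) | apply wave_slope_continuous | apply wave_slope_continuous].
  - unfold B.
    assert (K := RInt_opp (V := R_CompleteNormedModule) (fun s => xd (s - u) * xd s) a b).
    unfold opp in K; simpl in K. rewrite <- K.
    + apply RInt_ext. intros s _.
      change (- xd (s - u) * xd s = - (xd (s - u) * xd s) :> R). ring.
    + apply ex_RInt_continuous_R. intros t.
      apply continuous_mult_R; [apply continuous_comp_shift |]; apply wave_slope_continuous.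
Qed.

Lemma correlation_0 : A 0 = 0.
Proof.
  assert (H : is_RInt (fun s => x (s - 0) * xd s) a b
                (minus ((fun s => x s * x s / 2) b) ((fun s => x s * x s / 2) a))).
  { apply (is_RInt_derive (V := R_CompleteNormedModule) (fun s => x s * x s / 2)).
    - intros s _. rewrite Rminus_0_r. assert (D := wave_derive W s).
      auto_derive; [repeat split; eexists; exact D |].
      rewrite (is_derive_unique (fun r : R => x r) _ _ D). unfold xd. field.
    - intros s _. apply continuous_mult_R; [| apply wave_slope_continuous].
      apply continuous_comp_shift, (wave_continuous W). }
  unfold A. rewrite (is_RInt_unique _ _ _ _ H).
  unfold minus, plus, opp, a, b; simpl. rewrite (wave_min_eq W). ring.
Qed.

Lemma slope_autocorrelation_even (v : R) : B (- v) = B v.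
Proof.
  assert (Hc : forall t, continuous (fun r => xd (r - v) * xd r) t).
  { intros t. apply continuous_mult_R; [apply continuous_comp_shift |]; apply wave_slope_continuous. }
  unfold B.
  rewrite (RInt_ext _ (fun s => (fun r => xd (r - v) * xd r) (s + v))).
  2: { intros s _. cbv beta. replace (s + v - v) with s by ring.
       replace (s - - v) with (s + v) by ring. apply Rmult_comm. }
  rewrite (RInt_shift (fun r => xd (r - v) * xd r)) by exact Hc.
  replace (b + v) with ((a + v) + (q + qb)) by (unfold a, b; ring).
  replace b with (a + (q + qb)) by (unfold a, b; ring).
  apply RInt_periodic; auto.
  intros t. replace (t + (q + qb) - v) with (t - v + (q + qb)) by ring. now rewrite !wave_slope_periodic.
Qed.

(** By the equation f(x(s-u)) = -x'(s-(u-1)), so the nonlinear part of J is an autocorrelation of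
    the slope at shift u - 1. Its evenness, a consequence of periodicity, moves the shift to 1 - u,
    inside [0,1]. *)
Lemma excess_correlation_split (u : R) : J u = - B (1 - u) - PI / 2 * A u.
Proof.
  replace (1 - u) with (- (u - 1)) by ring. rewrite slope_autocorrelation_even.
  assert (H1 : forall t, continuous (fun s => xd (s - (u - 1)) * xd s) t).
  { intros t. apply continuous_mult_R; [apply continuous_comp_shift |]; apply wave_slope_continuous. }
  assert (H2 : forall t, continuous (fun s => x (s - u) * xd s) t).
  { intros t. apply continuous_mult_R; [apply continuous_comp_shift, (wave_continuous W) | apply wave_slope_continuous]. }
  apply (is_RInt_unique (V := R_CompleteNormedModule)).
  apply (is_RInt_ext (V := R_NormedModule)
     (fun s => minus (opp (xd (s - (u - 1)) * xd s)) (scal (PI / 2) (x (s - u) * xd s)))).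
  { intros s _. unfold minus, plus, opp, scal; simpl. unfold mult; simpl.
    unfold g. unfold xd at 1. replace (s - (u - 1) - 1) with (s - u) by ring. ring. }
  apply (is_RInt_minus (V := R_NormedModule)).
  - apply (is_RInt_opp (V := R_NormedModule)).
    apply (RInt_correct (V := R_CompleteNormedModule)), ex_RInt_continuous_R, H1.
  - apply (is_RInt_scal (V := R_NormedModule)).
    apply (RInt_correct (V := R_CompleteNormedModule)), ex_RInt_continuous_R, H2.
Qed.

Lemma wave_steep_contradiction : False.
Proof.
  assert (HPI := PI_RGT_0).
  set (k := fun r => sin (PI * r / 2) * A r).
  assert (Hk : forall t, continuous k t).
  { intros t. apply continuous_mult_R.
    - apply (ex_derive_continuous (fun r : R => sin (PI * r / 2))). auto_derive. auto.
    - eapply continuous_of_is_derive, correlation_derive. }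
  set (E := RInt k 0).
  assert (HE : forall t, is_derive E t (k t)) by (intros; now apply is_derive_RInt_upper).
  set (Y := fun u => cos (PI * u / 2) * A u + PI / 2 * (E u + E (1 - u))).
  assert (HY : forall u : R, is_derive Y u (cos (PI * u / 2) * J (1 - u))).
  { intros u. assert (D1 := correlation_derive u). assert (D2 := HE u). assert (D3 := HE (1 - u)).
    unfold Y. auto_derive.
    - repeat split; eexists; [exact D1 | exact D2 | exact D3].
    - rewrite (is_derive_unique (fun r : R => A r) _ _ D1),
        (is_derive_unique (fun r : R => E r) _ _ D2).
      replace (1 + - u) with (1 - u) by ring.
      rewrite (is_derive_unique (fun r : R => E r) _ _ D3).
      rewrite excess_correlation_split. replace (1 - (1 - u)) with u by ring.
      unfold k. replace (PI * (1 - u) / 2) with (PI / 2 - PI * u / 2) by field.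
      rewrite sin_shift. unfold Rdiv. ring. }
  assert (Y01 : Y 0 = Y 1).
  { unfold Y. rewrite correlation_0. replace (PI * 1 / 2) with (PI / 2) by field. rewrite cos_PI2.
    rewrite Rminus_0_r, Rminus_diag. ring. }
  assert (Hdec : forall s t, 0 <= s -> s <= t -> t <= 1 -> Y t <= Y s).
  { intros s t H1 H2 H3.
    assert (K := is_derive_bound_above Y (fun u => cos (PI * u / 2) * J (1 - u)) s t 0 H2).
    assert (Y t - Y s <= 0 * (t - s)); [| lra].
    apply K; [auto |]. intros r Hr.
    assert (0 <= cos (PI * r / 2)) by (apply cos_ge_0; nra).
    assert (J (1 - r) <= 0) by (apply excess_correlation_nonpos; lra). nra. }
  (* [Y] does not increase on [0,1] and has equal end values, hence is constant there; yet its
     derivative at 0 is [J 1 < 0]. *)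
  assert (HY0 := HY 0). apply is_derive_Reals in HY0.
  replace (PI * 0 / 2) with 0 in HY0 by field. rewrite cos_0, Rminus_0_r, Rmult_1_l in HY0.
  assert (HJ := excess_correlation_1_neg).
  destruct (HY0 (- J 1)) as [d Hd]; [lra |].
  set (h := Rmin (d / 2) 1).
  assert (Hh : 0 < h) by (apply Rmin_pos; [assert (K := cond_pos d) |]; lra).
  assert (Hh1 : h <= 1) by apply Rmin_r. assert (Hh2 : h <= d / 2) by apply Rmin_l.
  specialize (Hd h). rewrite Rabs_pos_eq in Hd by lra.
  rewrite Rplus_0_l in Hd.
  replace (Y h) with (Y 0) in Hd.
  2: { apply Rle_antisym; [rewrite Y01 |]; apply Hdec; lra. }
  replace ((Y 0 - Y 0) / h - J 1) with (- J 1) in Hd by (field; lra).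
  rewrite Rabs_pos_eq in Hd by lra. lra.
Qed.

End Amplitude.

Lemma wave_min_lt (alpha : R) (x : R -> R) (q qb : R) :
  wave alpha x q qb -> x (1 + q) < - ln (alpha / (PI / 2)).
Proof.
  intros W. apply Rnot_le_lt. intros H.
  assert (HPI := PI_RGT_0). pose proof (wave_alpha _ _ _ _ W) as Ha.
  apply (wave_steep_contradiction W). intros t.
  assert (H1 : exp (- ln (alpha / (PI / 2))) <= exp (x t)).
  { apply exp_le. apply Rle_trans with (1 := H). apply (wave_range W). }
  rewrite exp_Ropp, exp_ln in H1 by (apply Rdiv_lt_0_compat; lra).
  apply (Rmult_le_compat_l alpha) in H1; [| lra].
  replace (alpha * / (alpha / (PI / 2))) with (PI / 2) in H1 by (field; lra). exact H1.
Qed.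

(** * Soundness of the Pruning Algorithm *)

Lemma ite_true {T : Type} (Q : Prop) (a b : T) : Q -> ite Q a b = a.
Proof. intros H. unfold ite. now destruct excluded_middle_informative. Qed.

Lemma ite_false {T : Type} (Q : Prop) (a b : T) : ~ Q -> ite Q a b = b.
Proof. intros H. unfold ite. now destruct excluded_middle_informative. Qed.

Lemma ite_ind {T : Type} (C : T -> Prop) (Q : Prop) (a b : T) :
  (Q -> C a) -> (~ Q -> C b) -> C (ite Q a b).
Proof. intros Ha Hb. unfold ite. destruct excluded_middle_informative; auto. Qed.

Lemma Sup_is_lub (E : R -> Prop) (y B : R) :
  E y -> (forall z, E z -> z <= B) -> is_lub_Rbar E (Sup E).
Proof.
  intros Hy HB. unfold Sup. assert (H := Lub_Rbar_correct E).
  assert (H1 := proj1 H y Hy). assert (H2 := proj2 H B HB).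
  destruct (Lub_Rbar E); simpl in *; auto; contradiction.
Qed.

Lemma Inf_is_glb (E : R -> Prop) (y B : R) :
  E y -> (forall z, E z -> B <= z) -> is_glb_Rbar E (Inf E).
Proof.
  intros Hy HB. unfold Inf. assert (H := Glb_Rbar_correct E).
  assert (H1 := proj1 H y Hy). assert (H2 := proj2 H B HB).
  destruct (Glb_Rbar E); simpl in *; auto; contradiction.
Qed.

Lemma Sup_upper (E : R -> Prop) (y B : R) :
  E y -> (forall z, E z -> z <= B) -> y <= Sup E.
Proof. intros Hy HB. exact (proj1 (Sup_is_lub E y B Hy HB) y Hy). Qed.

Lemma Sup_least (E : R -> Prop) (y B : R) :
  E y -> (forall z, E z -> z <= B) -> Sup E <= B.
Proof. intros Hy HB. exact (proj2 (Sup_is_lub E y B Hy HB) B HB). Qed.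

Lemma Inf_lower (E : R -> Prop) (y B : R) :
  E y -> (forall z, E z -> B <= z) -> Inf E <= y.
Proof. intros Hy HB. exact (proj1 (Inf_is_glb E y B Hy HB) y Hy). Qed.

Lemma Inf_greatest (E : R -> Prop) (y B : R) :
  E y -> (forall z, E z -> B <= z) -> B <= Inf E.
Proof. intros Hy HB. exact (proj2 (Inf_is_glb E y B Hy HB) B HB). Qed.

Lemma sup_on_upper (a b : R) (f : R -> R) (t B : R) :
  a <= t <= b -> (forall s, a <= s <= b -> f s <= B) -> f t <= sup_on a b f.
Proof.
  intros Ht HB. apply (Sup_upper _ _ B); [now exists t |].
  intros z [s [Hs ->]]. auto.
Qed.

Lemma inf_on_lower (a b : R) (f : R -> R) (t B : R) :
  a <= t <= b -> (forall s, a <= s <= b -> B <= f s) -> inf_on a b f <= f t.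
Proof.
  intros Ht HB. apply (Inf_lower _ _ B); [now exists t |].
  intros z [s [Hs ->]]. auto.
Qed.

Definition locally_bounded_above (f : R -> R) : Prop :=
  forall a b, exists B, forall t, a <= t <= b -> f t <= B.

Definition locally_bounded_below (f : R -> R) : Prop :=
  forall a b, exists B, forall t, a <= t <= b -> B <= f t.

(* Local boundedness of the bounding functions keeps [Sup] and [Inf] away from
   their junk value 0. *)
Record encloses (K : region) (x : R -> R) (q qb : R) : Prop := Encloses {
  enc_box : in_box K (q, qb, x 1);
  enc_ell : forall t, ell K t <= x t;
  enc_upp : forall t, x t <= upp K t;
  enc_ell_bounded : locally_bounded_below (ell K);
  enc_upp_bounded : locally_bounded_above (upp K) }.

Section Pruning.
Context (P : params) {alpha : R} {x : R -> R} {q qb : R} (W : wave alpha x q qb).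
Context (Hmin : PI / 2 < alpha_min P) (Halpha : alpha_min P <= alpha <= alpha_max P).

Lemma alpha_min_pos : 0 < alpha_min P.
Proof. assert (H := PI_RGT_0). lra. Qed.

(** The windows are the times at which every admissible pair (q, qb) forces the sign of x; the
    windows before -qb and after L are brought back to [0, q] by one period. *)
Lemma P1_encloses (K : region) : encloses K x q qb -> encloses (P1 K) x q qb.
Proof.
  intros [Hb Hl Hu Hlb Hub].
  assert (Hbox := Hb). simpl in Hbox. destruct Hbox as [Hq [Hqb HM]].
  pose proof (wave_q _ _ _ _ W) as Hq1. pose proof (wave_qb _ _ _ _ W) as Hqb1.
  constructor; simpl.
  - auto.
  - intros t. specialize (Hl t). apply ite_ind; [intros -> | intros Ht1].
    + apply Rmax_lub; lra.
    + apply ite_ind; intros Ht; auto. apply Rmax_lub; auto. unfold L_min, L_max in Ht.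
      destruct Ht as [Ht | [Ht | Ht]].
      * rewrite <- (wave_per _ _ _ _ W). apply (wave_nonneg W). lra.
      * apply (wave_nonneg W). lra.
      * rewrite <- (wave_per_sub W). apply (wave_nonneg W). lra.
  - intros t. specialize (Hu t).
    assert (Hv : x t <= ite (t = 1) (Rmin (M_max K) (upp K 1)) (upp K t)).
    { apply ite_ind; [intros -> | auto]. apply Rmin_glb; lra. }
    apply ite_ind; intros Ht; auto. apply Rmin_glb; auto. unfold L_min in Ht.
    destruct Ht as [Ht | Ht].
    + apply (wave_nonpos_before W). lra.
    + apply (wave_nonpos W). lra.
  - intros a b. destruct (Hlb a b) as [B HB]. exists B. intros t Ht. specialize (HB t Ht).
    apply ite_ind; [intros -> | intros _].
    + eapply Rle_trans; [exact HB | apply Rmax_r].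
    + apply ite_ind; intros _; auto. eapply Rle_trans; [exact HB | apply Rmax_r].
  - intros a b. destruct (Hub a b) as [B HB]. exists B. intros t Ht. specialize (HB t Ht).
    assert (Hv : ite (t = 1) (Rmin (M_max K) (upp K 1)) (upp K t) <= B).
    { apply ite_ind; [intros -> | auto]. eapply Rle_trans; [apply Rmin_r | exact HB]. }
    apply ite_ind; intros _; auto. eapply Rle_trans; [apply Rmin_r | exact Hv].
Qed.

Lemma wave_slopes (K : region) (t0 sgn r : R) :
  encloses K x q qb -> 0 <= r <= / INR (n_time P) ->
  slopes P K t0 sgn (- alpha * (exp (x (t0 - 1 + sgn * r)) - 1)).
Proof.
  intros [Hb Hl Hu _ _] Hr. exists alpha, r, x. repeat split; auto; apply Halpha || apply Hr.
Qed.

Lemma slopes_bounded_above (K : region) (t0 sgn y : R) :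
  slopes P K t0 sgn y -> y <= alpha_max P.
Proof.
  intros [al [r [z [Hal [Hr [Hz ->]]]]]].
  pose proof (exp_pos (z (t0 - 1 + sgn * r))). pose proof alpha_min_pos. nra.
Qed.

(** Above, the slopes are bounded by [alpha_max] because exp is positive. Below, an upper bound on
    [upp] is needed over all delayed times reached with either sign. *)
Lemma slopes_bounded_below (K : region) (t0 sgn : R) :
  encloses K x q qb -> Rabs sgn <= 1 ->
  exists B, forall y, slopes P K t0 sgn y -> B <= y.
Proof.
  intros [_ _ _ _ Hub] Hsgn.
  destruct (Hub (t0 - 1 - / INR (n_time P)) (t0 - 1 + / INR (n_time P))) as [B HB].
  exists (- alpha_max P * exp B).
  intros y [al [r [z [Hal [Hr [Hz ->]]]]]].
  assert (H : Rabs (sgn * r) <= / INR (n_time P)).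
  { rewrite Rabs_mult. rewrite (Rabs_pos_eq r) by lra. pose proof (Rabs_pos sgn). nra. }
  apply Rabs_le_between in H.
  assert (H1 : exp (z (t0 - 1 + sgn * r)) <= exp B).
  { apply exp_le. apply Rle_trans with (1 := proj2 (Hz _)). apply HB. lra. }
  pose proof (exp_pos (z (t0 - 1 + sgn * r))). pose proof alpha_min_pos.
  assert (al * exp (z (t0 - 1 + sgn * r)) <= alpha_max P * exp B) by (apply Rmult_le_compat; lra).
  lra.
Qed.

Lemma le_Sup_slopes (K : region) (t0 sgn r : R) :
  encloses K x q qb -> 0 <= r <= / INR (n_time P) ->
  - alpha * (exp (x (t0 - 1 + sgn * r)) - 1) <= Sup (slopes P K t0 sgn).
Proof.
  intros HK Hr. apply (Sup_upper _ _ (alpha_max P)).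
  - now apply wave_slopes.
  - apply slopes_bounded_above.
Qed.

Lemma Inf_slopes_le (K : region) (t0 sgn r : R) :
  encloses K x q qb -> Rabs sgn <= 1 -> 0 <= r <= / INR (n_time P) ->
  Inf (slopes P K t0 sgn) <= - alpha * (exp (x (t0 - 1 + sgn * r)) - 1).
Proof.
  intros HK Hsgn Hr. destruct (slopes_bounded_below K t0 sgn HK Hsgn) as [B HB].
  apply (Inf_lower _ _ B); auto. now apply wave_slopes.
Qed.

(** The actual slopes between t0 and t are among [slopes], with x itself as the admissible function:
    the delayed time is t0 - 1 plus an offset of size at most Delta. A mean value estimate
    concludes. *)
Lemma upp''_above (G : R -> Prop) (K : region) (t y : R) :
  encloses K x q qb -> upp'' P G K t y -> x t <= y.
Proof.
  intros HK [n [s [_ [Hs [[-> ->] | [-> ->]]]]]]; set (t0 := IZR n * _) in *;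
    assert (Hu := enc_upp _ _ _ _ HK t0).
  - assert (H : x (t0 + s) - x t0 <= Sup (slopes P K t0 1) * ((t0 + s) - t0)); [| lra].
    apply (is_derive_bound_above x (fun t => - alpha * (exp (x (t - 1)) - 1))); [lra | |].
    + intros; apply (wave_derive W).
    + intros r Hr. replace (r - 1) with (t0 - 1 + 1 * (r - t0)) by ring.
      apply le_Sup_slopes; auto. lra.
  - assert (H : Inf (slopes P K t0 (-1)) * (t0 - (t0 - s)) <= x t0 - x (t0 - s)); [| lra].
    apply (is_derive_bound_below x (fun t => - alpha * (exp (x (t - 1)) - 1))); [lra | |].
    + intros; apply (wave_derive W).
    + intros r Hr. replace (r - 1) with (t0 - 1 + -1 * (t0 - r)) by ring.
      apply Inf_slopes_le; auto; [rewrite Rabs_left |]; lra.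
Qed.

Lemma ell''_below (G : R -> Prop) (K : region) (t y : R) :
  encloses K x q qb -> ell'' P G K t y -> y <= x t.
Proof.
  intros HK [n [s [_ [Hs [[-> ->] | [-> ->]]]]]]; set (t0 := IZR n * _) in *;
    assert (Hl := enc_ell _ _ _ _ HK t0).
  - assert (H : Inf (slopes P K t0 1) * ((t0 + s) - t0) <= x (t0 + s) - x t0); [| lra].
    apply (is_derive_bound_below x (fun t => - alpha * (exp (x (t - 1)) - 1))); [lra | |].
    + intros; apply (wave_derive W).
    + intros r Hr. replace (r - 1) with (t0 - 1 + 1 * (r - t0)) by ring.
      apply Inf_slopes_le; auto; [rewrite Rabs_pos_eq |]; lra.
  - assert (H : x t0 - x (t0 - s) <= Sup (slopes P K t0 (-1)) * (t0 - (t0 - s))); [| lra].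
    apply (is_derive_bound_above x (fun t => - alpha * (exp (x (t - 1)) - 1))); [lra | |].
    + intros; apply (wave_derive W).
    + intros r Hr. replace (r - 1) with (t0 - 1 + -1 * (t0 - r)) by ring.
      apply le_Sup_slopes; auto. lra.
Qed.

(** The old value belongs to the set, so the bound only tightens, and [x t] bounds the set below, so
    the infimum is finite. *)
Lemma P2_upp_between (G : R -> Prop) (K : region) (t : R) :
  encloses K x q qb -> x t <= upp (P2 P G K) t <= upp K t.
Proof.
  intros HK.
  assert (H : forall z, z = upp K t \/ upp'' P G K t z -> x t <= z).
  { intros z [-> | Hz]; [apply (enc_upp _ _ _ _ HK) | now apply (upp''_above G K)]. }
  split.
  - apply (Inf_greatest _ (upp K t)); auto.
  - apply (Inf_lower _ _ (x t)); auto.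
Qed.

Lemma P2_ell_between (G : R -> Prop) (K : region) (t : R) :
  encloses K x q qb -> ell K t <= ell (P2 P G K) t <= x t.
Proof.
  intros HK.
  assert (H : forall z, z = ell K t \/ ell'' P G K t z -> z <= x t).
  { intros z [-> | Hz]; [apply (enc_ell _ _ _ _ HK) | now apply (ell''_below G K)]. }
  split.
  - apply (Sup_upper _ _ (x t)); auto.
  - apply (Sup_least _ (ell K t)); auto.
Qed.

Lemma P2_encloses (G : R -> Prop) (K : region) :
  encloses K x q qb -> encloses (P2 P G K) x q qb.
Proof.
  intros HK. constructor.
  - exact (enc_box _ _ _ _ HK).
  - intros t. now apply P2_ell_between.
  - intros t. now apply P2_upp_between.
  - intros a b. destruct (enc_ell_bounded _ _ _ _ HK a b) as [B HB]. exists B. intros t Ht.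
    apply Rle_trans with (1 := HB t Ht). now apply P2_ell_between.
  - intros a b. destruct (enc_upp_bounded _ _ _ _ HK a b) as [B HB]. exists B. intros t Ht.
    apply Rle_trans with (2 := HB t Ht). now apply P2_upp_between.
Qed.

(** Since x(q) = 0 lies between the bounding functions, [q] itself belongs to both sets. *)
Lemma P3_encloses (K : region) :
  encloses K x q qb ->
  exists K', P3 K = Some K' /\ encloses K' x q qb /\ ell K' = ell K /\ upp K' = upp K.
Proof.
  intros HK. destruct HK as [Hb Hl Hu Hlb Hub].
  assert (Hbox := Hb). simpl in Hbox. destruct Hbox as [Hq [Hqb HM]].
  unfold P3.
  set (El := fun t => q_min K <= t <= q_max K /\ ell K t <= 0).
  set (Eu := fun t => q_min K <= t <= q_max K /\ 0 <= upp K t).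
  assert (Hel : El q). { split; auto. rewrite <- (wave_zq W). apply Hl. }
  assert (Heu : Eu q). { split; auto. rewrite <- (wave_zq W). apply Hu. }
  assert (Hlo : is_glb_Rbar El (Inf El)).
  { apply (Inf_is_glb _ q (q_min K)); auto. intros z [Hz _]. lra. }
  assert (Hhi : is_lub_Rbar Eu (Sup Eu)).
  { apply (Sup_is_lub _ q (q_max K)); auto. intros z [Hz _]. lra. }
  rewrite (is_glb_Rbar_unique _ _ Hlo), (is_lub_Rbar_unique _ _ Hhi).
  assert (H1 : Inf El <= q) by apply (proj1 Hlo q Hel).
  assert (H2 : q <= Sup Eu) by apply (proj1 Hhi q Heu).
  rewrite ite_true by (simpl; lra).
  eexists. split; [reflexivity |]. split; [| split; reflexivity].
  constructor; auto. simpl. split; [lra |]. split; [exact Hqb |].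
  split; [apply Rmax_lub | apply Rmin_glb]; auto; lra.
Qed.

Lemma P4_encloses (K : region) : encloses K x q qb -> encloses (P4 K) x q qb.
Proof.
  intros HK. destruct HK as [Hb Hl Hu Hlb Hub].
  assert (Hbox := Hb). simpl in Hbox. destruct Hbox as [Hq [Hqb HM]].
  assert (HL : L_min K <= q + qb <= L_max K) by (unfold L_min, L_max; lra).
  constructor; simpl; auto.
  - intros t. apply Rmax_lub; auto.
    destruct (Hlb (t + L_min K) (t + L_max K)) as [B HB].
    apply Rle_trans with (ell K (t + (q + qb))).
    + apply (inf_on_lower _ _ (fun L => ell K (t + L)) _ B); auto. intros s Hs. apply HB. lra.
    + rewrite <- (wave_per _ _ _ _ W t). apply Hl.
  - intros t. apply Rmin_glb; auto.
    destruct (Hub (t + L_min K) (t + L_max K)) as [B HB].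
    apply Rle_trans with (upp K (t + (q + qb))).
    + rewrite <- (wave_per _ _ _ _ W t). apply Hu.
    + apply (sup_on_upper _ _ (fun L => upp K (t + L)) _ B); auto. intros s Hs. apply HB. lra.
  - intros a b. destruct (Hlb a b) as [B HB]. exists B. intros t Ht.
    eapply Rle_trans; [apply HB, Ht | apply Rmax_l].
  - intros a b. destruct (Hub a b) as [B HB]. exists B. intros t Ht.
    eapply Rle_trans; [apply Rmin_l | apply HB, Ht].
Qed.

(** The minimum is attained at [q + 1], one of the times tested, and the amplitude bound at [alpha]
    implies the weaker one at [alpha_min P]. *)
Lemma P6_not_empty (K : region) : encloses K x q qb -> ~ P6_empty P K.
Proof.
  intros HK H. unfold P6_empty in H. destruct HK as [Hb Hl Hu Hlb Hub].
  simpl in Hb. destruct Hb as [Hq _].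
  destruct (Hlb (q_min K + 1) (q_max K + 1)) as [B HB].
  assert (H1 : inf_on (q_min K) (q_max K) (fun t => ell K (t + 1)) <= ell K (q + 1)).
  { apply (inf_on_lower _ _ (fun t => ell K (t + 1)) _ B); auto. intros s Hs. apply HB. lra. }
  assert (H2 := Hl (q + 1)). assert (H3 := wave_min_lt _ _ _ _ W).
  rewrite Rplus_comm in H3.
  assert (HPI := PI_RGT_0).
  assert (H4 : ln (alpha_min P / (PI / 2)) <= ln (alpha / (PI / 2))).
  { apply ln_le.
    - apply Rdiv_lt_0_compat; lra.
    - apply Rmult_le_compat_r; [apply Rlt_le, Rinv_0_lt_compat |]; lra. }
  lra.
Qed.

Lemma prune_encloses (K : region) :
  encloses K x q qb -> exists K', prune P K = Some K' /\ encloses K' x q qb.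
Proof.
  intros HK. unfold prune.
  destruct (P3_encloses (P2 P (fun _ => True) (P1 K))) as [K3 [-> [H3 _]]].
  { now apply P2_encloses, P1_encloses. }
  assert (H4 := P4_encloses K3 H3). exists (P4 K3). split; auto.
  apply ite_false. intros [[t Ht] | [H | H]].
  - assert (K1 := enc_ell _ _ _ _ H4 t). assert (K2 := enc_upp _ _ _ _ H4 t). lra.
  - exact (P6_not_empty _ H4 H).
  - apply H. eexists. exact (enc_box _ _ _ _ H4).
Qed.

Lemma prune_iter_encloses (n : nat) (K : region) :
  encloses K x q qb -> exists K', prune_iter P n K = Some K' /\ encloses K' x q qb.
Proof.
  intros HK. induction n as [| n [K' [E HK']]].
  - now exists K.
  - unfold prune_iter in *. simpl. rewrite E. now apply prune_encloses.
Qed.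

(** The loop invariant. On the working list the bounding functions must still enclose x, since
    pruning will use them again; on the accepted list only the box counts. *)
Definition covered (st : list region * list region) : Prop :=
  (exists K, In K (fst st) /\ encloses K x q qb) \/
  (exists K, In K (snd st) /\ in_box K (q, qb, x 1)).

Lemma bisect_box_cover (K KA KB : box) (k : R * R * R) :
  bisect_box K KA KB -> in_box K k -> in_box KA k \/ in_box KB k.
Proof.
  intros H Hk. destruct k as [[k1 k2] k3].
  destruct H as [a b c d e f K _ _ | a b c d e f K _ _ | a b c d e f K _ _];
    unfold K in Hk; simpl in *; destruct Hk as [H1 [H2 H3]].
  - destruct (Rle_lt_dec k1 ((a + b) / 2)); [left | right]; lra.
  - destruct (Rle_lt_dec k2 ((c + d) / 2)); [left | right]; lra.
  - destruct (Rle_lt_dec k3 ((e + f) / 2)); [left | right]; lra.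
Qed.

Lemma bp_step_covered (st st' : list region * list region) :
  bp_step P st st' -> covered st -> covered st'.
Proof.
  intros Hstep [[K0 [Hin HK0]] | [K0 [Hin HK0]]].
  - assert (Hsplit : forall S1 S2 K, In K0 (S1 ++ K :: S2) -> K0 = K \/ In K0 (S1 ++ S2)).
    { intros S1 S2 K H. apply in_app_or in H. simpl in H.
      destruct H as [H | [H | H]]; auto; right; apply in_or_app; auto. }
    destruct (prune_iter_encloses (n_prune P) K0 HK0) as [K0' [E0 HK0']].
    destruct Hstep as [S1 S2 A K E | S1 S2 A K K' E Hs | S1 S2 A K K' KA KB E Hs Hbis];
      simpl in Hin; destruct (Hsplit _ _ _ Hin) as [-> | Hin'].
    + congruence.
    + left. now exists K0.
    + right. exists K'. split; [now left |]. replace K' with K0' by congruence. apply HK0'.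
    + left. now exists K0.
    + left. replace K0' with K' in HK0' by congruence.
      destruct HK0' as [Hb Hl Hu Hlb Hub].
      destruct (bisect_box_cover _ _ _ _ Hbis Hb) as [H | H]; eexists; split.
      * left. reflexivity.
      * constructor; auto.
      * right. left. reflexivity.
      * constructor; auto.
    + left. exists K0. split; auto. simpl. auto.
  - right. destruct Hstep as [S1 S2 A K E | S1 S2 A K K' E Hs | S1 S2 A K K' KA KB E Hs Hbis];
      simpl in *; exists K0; simpl; auto.
Qed.

Lemma bp_output_covered (A : list region) :
  (exists K, In K (bp_init P) /\ encloses K x q qb) -> bp_output P A ->
  exists K, In K A /\ in_box K (q, qb, x 1).
Proof.
  intros Hinit Hout. unfold bp_output in Hout.
  assert (H : forall st st', clos_refl_trans _ (bp_step P) st st' -> covered st -> covered st').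
  { intros st st' Hst. induction Hst; auto. now apply bp_step_covered. }
  destruct (H _ _ Hout (or_introl Hinit)) as [[K [[] _]] | HK]. exact HK.
Qed.

End Pruning.

(** * The initial regions *)

Lemma ex_derive_a_seq (j : nat) (alpha : R) : ex_derive (a_seq j) alpha.
Proof.
  unfold a_seq. induction (j - 1)%nat as [| n IH].
  - simpl. auto_derive. auto.
  - assert (Hstep : forall h : R -> R, ex_derive h alpha ->
                      ex_derive (fun a => a * (exp (h a) - 1)) alpha).
    { intros h Hh. auto_derive. auto. }
    exact (Hstep _ IH).
Qed.

Lemma a_iter_neg (n : nat) (alpha : R) :
  1 < alpha -> Nat.iter n (fun y => alpha * (exp y - 1)) (- (alpha - 1)) < 0.
Proof.
  intros Ha. induction n as [| n IH]; simpl; [lra |].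
  apply exp_lt_1 in IH. nra.
Qed.

Lemma continuous_bounded_above (f : R -> R) (a b : R) :
  a <= b -> (forall t, a <= t <= b -> continuous f t) ->
  exists B, forall t, a <= t <= b -> f t <= B.
Proof.
  intros Hab Hf. destruct (continuity_ab_maj f a b Hab) as [m [Hm _]].
  - intros t Ht. apply continuity_pt_filterlim, Hf, Ht.
  - now exists (f m).
Qed.

Lemma continuous_bounded_below (f : R -> R) (a b : R) :
  a <= b -> (forall t, a <= t <= b -> continuous f t) ->
  exists B, forall t, a <= t <= b -> B <= f t.
Proof.
  intros Hab Hf. destruct (continuity_ab_min f a b Hab) as [m [Hm _]].
  - intros t Ht. apply continuity_pt_filterlim, Hf, Ht.
  - now exists (f m).
Qed.

Section Initial.
Context (P : params) {alpha : R} {x : R -> R} {q qb : R} (W : wave alpha x q qb).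
Context (Hmin : PI / 2 < alpha_min P) (Halpha : alpha_min P <= alpha <= alpha_max P).

Let Hone : 1 < alpha_min P.
Proof. assert (H := PI2_1). lra. Qed.

Lemma q_under_le : q_under P <= q.
Proof.
  unfold q_under, inf_alpha.
  set (f := fun alpha => 1 / alpha * ((alpha + exp (- alpha) - 1) / (exp (alpha + exp (- alpha) - 1) - 1))).
  assert (H : inf_on (alpha_min P) (alpha_max P) f <= f alpha).
  { apply (inf_on_lower _ _ f _ 0); [lra |]. intros a Ha. unfold f.
    assert (K1 := exp_ge_1_plus (- a)). assert (K2 := exp_ineq1 (- a) ltac:(lra)).
    assert (K3 := exp_gt_1 (a + exp (- a) - 1) ltac:(lra)).
    apply Rmult_le_pos; apply Rlt_le, Rdiv_lt_0_compat; lra. }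
  assert (H1 := wave_q_ge W). unfold f in *. lra.
Qed.

Lemma q_le_two_plus : q <= 2 + 1 / alpha_min P.
Proof.
  assert (H := wave_q_le W ltac:(lra)).
  assert (1 / alpha <= 1 / alpha_min P).
  { unfold Rdiv. apply Rmult_le_compat_l; [lra |]. apply Rinv_le_contravar; lra. }
  lra.
Qed.

Lemma max_le_p_i0 : x 1 <= p_i0 P 1.
Proof.
  unfold p_i0, p_seq.
  destruct (wave_p_iter_bounds W (alpha_max P) (i0 P - 1)) as [_ [_ H]]; [lra |].
  apply H. lra.
Qed.

Lemma p_i0_pos : 0 < p_i0 P 1.
Proof. assert (H := max_le_p_i0). assert (K := wave_max_pos W). lra. Qed.

(** Combine -alpha (e^{x(1)} - 1) <= min x with min x < -log(alpha/(pi/2)) and solve for x(1). *)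
Lemma max_ge_log :
  inf_alpha P (fun alpha => ln (1 + / alpha * ln (alpha / (PI / 2)))) <= x 1.
Proof.
  assert (HPI := PI_RGT_0).
  set (f := fun alpha => ln (1 + / alpha * ln (alpha / (PI / 2)))).
  assert (Hpos : forall a, alpha_min P <= a -> 0 <= / a * ln (a / (PI / 2))).
  { intros a Ha. apply Rmult_le_pos; [apply Rlt_le, Rinv_0_lt_compat; lra |].
    rewrite <- ln_1. apply ln_le; [lra |].
    apply (Rmult_le_reg_r (PI / 2)); [lra |].
    replace (a / (PI / 2) * (PI / 2)) with a by (field; lra). lra. }
  apply Rle_trans with (f alpha).
  - apply (inf_on_lower _ _ f _ 0); [lra |]. intros a Ha. unfold f.
    rewrite <- ln_1. apply ln_le; [lra |]. specialize (Hpos a). lra.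
  - unfold f. rewrite <- (ln_exp (x 1)). apply ln_le.
    + specialize (Hpos alpha). lra.
    + assert (H1 := wave_min_lt _ _ _ _ W). assert (H2 := wave_min_ge W).
      apply (Rmult_le_reg_l alpha); [lra |].
      replace (alpha * (1 + / alpha * ln (alpha / (PI / 2)))) with (alpha + ln (alpha / (PI / 2)))
        by (field; lra). lra.
Qed.

Lemma K1_encloses : qb <= 3 -> encloses (K1 P) x q qb.
Proof.
  intros Hqb3.
  assert (Hlow : forall t, - alpha_max P * (exp (alpha_max P) - 1) <= x t).
  { intros t. apply Rle_trans with (2 := wave_ge W t).
    assert (K1 : exp alpha <= exp (alpha_max P)) by (apply exp_le; lra).
    assert (K2 := exp_gt_1 alpha ltac:(lra)).
    assert (alpha * (exp alpha - 1) <= alpha_max P * (exp (alpha_max P) - 1)); [| lra].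
    apply Rmult_le_compat; lra. }
  constructor; simpl.
  - split; [split |].
    + apply q_under_le.
    + apply ite_ind; intros H; [apply (wave_q_le_2 W); lra | apply q_le_two_plus].
    + split; [split; auto | split; [apply max_ge_log | apply max_le_p_i0]].
      apply Rle_trans with (2 := wave_qb_ge W). apply Rplus_le_compat_l.
      unfold Rdiv. apply Rmult_le_compat_l; [lra |]. apply Rinv_le_contravar; lra.
  - intros t. apply ite_ind; [intros -> | auto]. rewrite (wave_0 W). lra.
  - intros t. apply ite_ind; [intros -> | intros _].
    + rewrite (wave_0 W). lra.
    + apply Rle_trans with (2 := max_le_p_i0). apply (wave_range W).
  - intros a b. exists (- alpha_max P * (exp (alpha_max P) - 1)). intros t _.
    apply ite_ind; intros _; [rewrite <- (wave_0 W); auto | lra].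
  - intros a b. exists (p_i0 P 1). intros t _.
    assert (K := p_i0_pos). apply ite_ind; lra.
Qed.

Lemma K2_start_encloses : 3 <= qb -> encloses (K2_start P) x q qb.
Proof.
  intros Hqb3.
  destruct (wave_p_iter_bounds W (alpha_max P) (i0 P - 1)) as [Hpc [Hpn _]]; [lra |].
  fold (p_seq (alpha_max P) (i0 P)) in Hpc, Hpn. fold (p_i0 P) in Hpc, Hpn.
  assert (Haneg : forall a, alpha_min P <= a -> a_seq (j0 P) a < 0).
  { intros a Ha. apply a_iter_neg. lra. }
  assert (Hinf : inf_alpha P (fun alpha => - alpha * (exp alpha - 1)) <= - alpha * (exp alpha - 1)).
  { apply (inf_on_lower _ _ (fun alpha => - alpha * (exp alpha - 1)) _
      (- alpha_max P * (exp (alpha_max P) - 1))); [lra |]. intros a Ha.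
    assert (K1 : exp a <= exp (alpha_max P)) by (apply exp_le; lra).
    assert (K2 := exp_gt_1 a ltac:(lra)).
    assert (a * (exp a - 1) <= alpha_max P * (exp (alpha_max P) - 1)); [| lra].
    apply Rmult_le_compat; lra. }
  constructor; simpl.
  - split; [split; [apply q_under_le | apply q_le_two_plus] |].
    split; [split; auto | split; [apply Rlt_le, (wave_max_pos W) | apply max_le_p_i0]].
    set (f := fun alpha => 2 + Rabs ((exp alpha - 1) / (exp (a_seq (j0 P) alpha) - 1))).
    assert (Hne : forall a, alpha_min P <= a -> exp (a_seq (j0 P) a) - 1 <> 0).
    { intros a Ha. assert (K := exp_lt_1 _ (Haneg a Ha)). lra. }
    (* The supremum is finite because the quotient is continuous on the compact parameter interval:
       [a_seq] stays negative, so the denominator never vanishes. *)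
    destruct (continuous_bounded_above f (alpha_min P) (alpha_max P)) as [B HB]; [lra | |].
    { intros a Ha. unfold f.
      apply (continuous_comp (fun a => (exp a - 1) / (exp (a_seq (j0 P) a) - 1)) (fun y => 2 + Rabs y)).
      - assert (Hd := ex_derive_a_seq (j0 P) a). specialize (Hne a (proj1 Ha)).
        revert Hd Hne. generalize (a_seq (j0 P)). intros h Hd Hne.
        apply (ex_derive_continuous (fun a : R => (exp a - 1) / (exp (h a) - 1))).
        auto_derive. auto.
      - apply (continuous_plus (fun _ => 2) Rabs); [apply continuous_const | apply continuous_Rabs]. }
    apply Rle_trans with (f alpha); [| apply (sup_on_upper _ _ f _ B); auto; lra].
    assert (K := exp_lt_1 _ (Haneg alpha ltac:(lra))).
    assert (K' := exp_gt_1 alpha ltac:(lra)).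
    apply Rle_trans with (1 := wave_qb_le W _ Hqb3 (wave_minus_1_le_a_iter W (j0 P - 1) Hqb3)
                                 (Haneg alpha ltac:(lra))).
    unfold f. fold (a_seq (j0 P) alpha). apply Rplus_le_compat_l.
    replace ((exp alpha - 1) / (exp (a_seq (j0 P) alpha) - 1))
      with (- ((exp alpha - 1) / (1 - exp (a_seq (j0 P) alpha)))) by (field; lra).
    rewrite Rabs_Ropp. apply Rle_abs.
  - intros t. apply ite_ind; [intros -> | intros Ht0]; [rewrite (wave_0 W); lra |].
    apply ite_ind; intros Ht; [apply Hpn; lra |].
    apply Rle_trans with (1 := Hinf). apply (wave_ge W).
  - intros t. apply ite_ind; [intros -> | intros Ht0]; [rewrite (wave_0 W); lra |].
    apply ite_ind; intros Ht.
    + apply Rle_trans with (1 := wave_le_a_iter W (j0 P - 1) t Hqb3 ltac:(lra)).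
      apply (sup_on_upper _ _ (fun alpha => - t * a_seq (j0 P) alpha) alpha 0); [lra |].
      intros a Ha. assert (K := Haneg a ltac:(lra)). nra.
    + apply Rle_trans with (2 := max_le_p_i0). apply (wave_range W).
  - intros a b. destruct (Rle_lt_dec a b) as [Hab | Hab].
    2: { exists 0. intros; lra. }
    destruct (continuous_bounded_below (p_i0 P) a b Hab) as [B HB]; [auto |].
    set (I := inf_alpha P (fun alpha => - alpha * (exp alpha - 1))) in *.
    assert (HI : I <= 0).
    { apply Rle_trans with (1 := Hinf). assert (K := exp_gt_1 alpha ltac:(lra)). nra. }
    exists (Rmin B I). intros t Ht. specialize (HB t Ht).
    assert (K1 := Rmin_l B I). assert (K2 := Rmin_r B I).
    apply ite_ind; intros; [lra |]. apply ite_ind; intros; lra.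
  - intros a b. exists (p_i0 P 1). intros t _. assert (K := p_i0_pos).
    apply ite_ind; intros Ht0; [lra |]. apply ite_ind; intros Ht; [| lra].
    apply Rle_trans with 0; [| lra].
    apply (Sup_least _ (- t * a_seq (j0 P) alpha)); [exists alpha; split; [lra | auto] |].
    intros z [a' [Ha ->]]. assert (K1 := Haneg a' ltac:(lra)). nra.
Qed.

(** It keeps the divisor |e^{u(-1)} - 1| away from 0. A supremum of negative numbers could still be
    0; here it is attained, by compactness. *)
Lemma K2_start_upp_minus_1 : upp (K2_start P) (-1) < 0.
Proof.
  simpl. rewrite ite_false by lra. rewrite ite_true by lra.
  destruct (continuity_ab_maj (fun a => - -1 * a_seq (j0 P) a) (alpha_min P) (alpha_max P))
    as [m [Hm1 Hm2]]; [lra | |].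
  - intros a Ha. apply continuity_pt_filterlim.
    apply (continuous_mult_R (fun _ => - -1) (a_seq (j0 P))); [apply continuous_const |].
    apply (ex_derive_continuous (a_seq (j0 P))), ex_derive_a_seq.
  - apply Rle_lt_trans with (- -1 * a_seq (j0 P) m).
    + apply (Sup_least _ (- -1 * a_seq (j0 P) m)); [now exists m |].
      intros z [a [Ha ->]]. now apply Hm1.
    + assert (a_seq (j0 P) m < 0) by (apply a_iter_neg; lra). lra.
Qed.

End Initial.

(** * Riemann integrability of the bounding functions *)

Definition one_sided (F : (R -> Prop) -> Prop) : Prop :=
  exists t, F = at_right t \/ F = at_left t.

Lemma one_sided_filter (F : (R -> Prop) -> Prop) : one_sided F -> Filter F.
Proof. intros [t [-> | ->]]; apply within_filter, locally_filter. Qed.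

(* Asking for one-sided germs at every point, instead of a list of break points,
   makes closure under max, min and composition immediate; compactness enters only
   in the proof of integrability. *)
Definition piecewise_continuous (f : R -> R) : Prop :=
  forall F, one_sided F ->
  exists g : R -> R, (forall s, continuous g s) /\ F (fun s => f s = g s).

Lemma at_right_iff (t : R) (Q : R -> Prop) :
  at_right t Q <-> exists d, 0 < d /\ forall s, t < s < t + d -> Q s.
Proof.
  split.
  - intros [d Hd]. exists d. split; [apply cond_pos |]. intros s Hs. apply Hd; [| lra].
    apply Rabs_def1; unfold minus, plus, opp; simpl; lra.
  - intros [d [Hd H]]. exists (mkposreal d Hd). intros s Hs Hts. apply H.
    apply Rabs_def2 in Hs. unfold minus, plus, opp in Hs; simpl in Hs. lra.
Qed.

Lemma at_left_iff (t : R) (Q : R -> Prop) :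
  at_left t Q <-> exists d, 0 < d /\ forall s, t - d < s < t -> Q s.
Proof.
  split.
  - intros [d Hd]. exists d. split; [apply cond_pos |]. intros s Hs. apply Hd; [| lra].
    apply Rabs_def1; unfold minus, plus, opp; simpl; lra.
  - intros [d [Hd H]]. exists (mkposreal d Hd). intros s Hs Hts. apply H.
    apply Rabs_def2 in Hs. unfold minus, plus, opp in Hs; simpl in Hs. lra.
Qed.

Lemma piecewise_continuous_of_continuous (f : R -> R) :
  (forall t, continuous f t) -> piecewise_continuous f.
Proof.
  intros Hf F HF. pose proof (one_sided_filter F HF). exists f. split; auto.
  now apply filter_forall.
Qed.

(** The property is local: a different comparison function may be chosen for each one-sided germ. *)
Lemma piecewise_continuous_patch (f : R -> R) :
  (forall F, one_sided F -> exists g, piecewise_continuous g /\ F (fun s => f s = g s)) ->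
  piecewise_continuous f.
Proof.
  intros H F HF. pose proof (one_sided_filter F HF).
  destruct (H F HF) as [g [Hg E]]. destruct (Hg F HF) as [h [Hh E']].
  exists h. split; auto. generalize (filter_and _ _ E E'). apply filter_imp.
  intros s [-> ->]. reflexivity.
Qed.

Lemma piecewise_continuous_ext (f g : R -> R) :
  (forall t, g t = f t) -> piecewise_continuous f -> piecewise_continuous g.
Proof.
  intros E Hf. apply piecewise_continuous_patch. intros F HF.
  pose proof (one_sided_filter F HF). exists f. split; auto. now apply filter_forall.
Qed.

Lemma piecewise_continuous_comp (phi f : R -> R) :
  (forall y, continuous phi y) -> piecewise_continuous f ->
  piecewise_continuous (fun t => phi (f t)).
Proof.
  intros Hphi Hf F HF. pose proof (one_sided_filter F HF).
  destruct (Hf F HF) as [g [Hg E]]. exists (fun s => phi (g s)). split.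
  - intros s. now apply (continuous_comp g phi).
  - revert E. apply filter_imp. intros s ->. reflexivity.
Qed.

Lemma piecewise_continuous_binary (op : R -> R -> R) (f g : R -> R) :
  (forall f' g' : R -> R, (forall s, continuous f' s) -> (forall s, continuous g' s) ->
     forall s, continuous (fun t => op (f' t) (g' t)) s) ->
  piecewise_continuous f -> piecewise_continuous g ->
  piecewise_continuous (fun t => op (f t) (g t)).
Proof.
  intros Hop Hf Hg F HF. pose proof (one_sided_filter F HF).
  destruct (Hf F HF) as [f' [Hf' E]]. destruct (Hg F HF) as [g' [Hg' E']].
  exists (fun s => op (f' s) (g' s)). split; auto.
  generalize (filter_and _ _ E E'). apply filter_imp. intros s [-> ->]. reflexivity.
Qed.

Lemma Rmax_abs (a b : R) : Rmax a b = (a + b + Rabs (a - b)) / 2.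
Proof. unfold Rmax, Rabs. destruct Rle_dec, Rcase_abs; lra. Qed.

Lemma Rmin_abs (a b : R) : Rmin a b = (a + b - Rabs (a - b)) / 2.
Proof. unfold Rmin, Rabs. destruct Rle_dec, Rcase_abs; lra. Qed.

Lemma continuous_Rabs_minus (f g : R -> R) (s : R) :
  continuous f s -> continuous g s -> continuous (fun t => Rabs (f t - g t)) s.
Proof.
  intros Hf Hg. apply (continuous_comp (fun t => f t - g t) Rabs).
  - now apply (continuous_minus f g).
  - apply continuous_Rabs.
Qed.

Lemma continuous_Rmax (f g : R -> R) (s : R) :
  continuous f s -> continuous g s -> continuous (fun t => Rmax (f t) (g t)) s.
Proof.
  intros Hf Hg. apply (continuous_ext (fun t => (f t + g t + Rabs (f t - g t)) * / 2)).
  { intros t. rewrite Rmax_abs. reflexivity. }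
  apply continuous_mult_R; [| apply continuous_const].
  apply (continuous_plus (fun t => f t + g t)); [now apply (continuous_plus f g) |].
  now apply continuous_Rabs_minus.
Qed.

Lemma continuous_Rmin (f g : R -> R) (s : R) :
  continuous f s -> continuous g s -> continuous (fun t => Rmin (f t) (g t)) s.
Proof.
  intros Hf Hg. apply (continuous_ext (fun t => (f t + g t - Rabs (f t - g t)) * / 2)).
  { intros t. rewrite Rmin_abs. reflexivity. }
  apply continuous_mult_R; [| apply continuous_const].
  apply (continuous_minus (fun t => f t + g t)); [now apply (continuous_plus f g) |].
  now apply continuous_Rabs_minus.
Qed.

Lemma piecewise_continuous_Rmax (f g : R -> R) :
  piecewise_continuous f -> piecewise_continuous g ->
  piecewise_continuous (fun t => Rmax (f t) (g t)).
Proof.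
  apply (piecewise_continuous_binary Rmax). intros; now apply continuous_Rmax.
Qed.

Lemma piecewise_continuous_Rmin (f g : R -> R) :
  piecewise_continuous f -> piecewise_continuous g ->
  piecewise_continuous (fun t => Rmin (f t) (g t)).
Proof.
  apply (piecewise_continuous_binary Rmin). intros; now apply continuous_Rmin.
Qed.

Lemma piecewise_continuous_const (c : R) : piecewise_continuous (fun _ => c).
Proof. apply piecewise_continuous_of_continuous. intros; apply continuous_const. Qed.

(** The admissible conditions of [ite]: each one-sided germ decides membership. *)
Definition one_sided_definite (D : R -> Prop) : Prop :=
  forall F, one_sided F -> F D \/ F (fun s => ~ D s).

Lemma one_sided_definite_le (c : R) : one_sided_definite (fun t => t <= c).
Proof.
  intros F [t [-> | ->]].
  - destruct (Rlt_le_dec t c) as [H | H]; [left | right]; apply at_right_iff.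
    + exists (c - t). split; [lra |]. intros s Hs. lra.
    + exists 1. split; [lra |]. intros s Hs. lra.
  - destruct (Rle_lt_dec t c) as [H | H]; [left | right]; apply at_left_iff.
    + exists 1. split; [lra |]. intros s Hs. lra.
    + exists (t - c). split; [lra |]. intros s Hs. lra.
Qed.

Lemma one_sided_definite_ge (c : R) : one_sided_definite (fun t => c <= t).
Proof.
  intros F [t [-> | ->]].
  - destruct (Rle_lt_dec c t) as [H | H]; [left | right]; apply at_right_iff.
    + exists 1. split; [lra |]. intros s Hs. lra.
    + exists (c - t). split; [lra |]. intros s Hs. lra.
  - destruct (Rlt_le_dec c t) as [H | H]; [left | right]; apply at_left_iff.
    + exists (t - c). split; [lra |]. intros s Hs. lra.
    + exists 1. split; [lra |]. intros s Hs. lra.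
Qed.

Lemma one_sided_definite_not (D : R -> Prop) :
  one_sided_definite D -> one_sided_definite (fun t => ~ D t).
Proof.
  intros HD F HF. pose proof (one_sided_filter F HF).
  destruct (HD F HF) as [H1 | H1]; [right | now left].
  revert H1. apply filter_imp. tauto.
Qed.

Lemma one_sided_definite_and (D D' : R -> Prop) :
  one_sided_definite D -> one_sided_definite D' -> one_sided_definite (fun t => D t /\ D' t).
Proof.
  intros HD HD' F HF. pose proof (one_sided_filter F HF).
  destruct (HD F HF) as [H1 | H1].
  - destruct (HD' F HF) as [H2 | H2].
    + left. now apply filter_and.
    + right. revert H2. apply filter_imp. tauto.
  - right. revert H1. apply filter_imp. tauto.
Qed.

Lemma one_sided_definite_iff (D D' : R -> Prop) :
  (forall t, D t <-> D' t) -> one_sided_definite D -> one_sided_definite D'.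
Proof.
  intros E HD F HF. pose proof (one_sided_filter F HF).
  destruct (HD F HF) as [H1 | H1]; [left | right]; revert H1; apply filter_imp;
    intros s; specialize (E s); tauto.
Qed.

Lemma one_sided_definite_or (D D' : R -> Prop) :
  one_sided_definite D -> one_sided_definite D' -> one_sided_definite (fun t => D t \/ D' t).
Proof.
  intros HD HD' F HF. pose proof (one_sided_filter F HF).
  destruct (HD F HF) as [H1 | H1].
  - left. revert H1. apply filter_imp. tauto.
  - destruct (HD' F HF) as [H2 | H2].
    + left. revert H2. apply filter_imp. tauto.
    + right. generalize (filter_and _ _ H1 H2). apply filter_imp. tauto.
Qed.

Lemma one_sided_definite_interval (a b : R) : one_sided_definite (fun t => a <= t <= b).
Proof.
  apply one_sided_definite_and; [apply one_sided_definite_ge | apply one_sided_definite_le].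
Qed.

Lemma one_sided_definite_eq (c : R) : one_sided_definite (fun t => t = c).
Proof.
  apply (one_sided_definite_iff (fun t => c <= t <= c)); [intros; lra |].
  apply one_sided_definite_interval.
Qed.

Lemma one_sided_definite_lt (c : R) : one_sided_definite (fun t => t < c).
Proof.
  apply (one_sided_definite_iff (fun t => ~ c <= t)); [intros; lra |].
  apply one_sided_definite_not, one_sided_definite_ge.
Qed.

Lemma piecewise_continuous_ite (D : R -> Prop) (f g : R -> R) :
  one_sided_definite D -> piecewise_continuous f -> piecewise_continuous g ->
  piecewise_continuous (fun t => ite (D t) (f t) (g t)).
Proof.
  intros HD Hf Hg. apply piecewise_continuous_patch. intros F HF.
  pose proof (one_sided_filter F HF).
  destruct (HD F HF) as [H1 | H1]; [exists f | exists g]; split; auto;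
    revert H1; apply filter_imp; intros s Hs; [now apply ite_true | now apply ite_false].
Qed.

Lemma piecewise_continuous_locally_ex_RInt (f : R -> R) (t : R) :
  piecewise_continuous f ->
  exists d, 0 < d /\ (forall u, t - d < u <= t -> ex_RInt f u t) /\
    (forall v, t <= v < t + d -> ex_RInt f t v).
Proof.
  intros Hf.
  destruct (Hf (at_right t)) as [g [Hg E]]; [exists t; auto |].
  destruct (Hf (at_left t)) as [h [Hh E']]; [exists t; auto |].
  apply at_right_iff in E. apply at_left_iff in E'.
  destruct E as [d1 [Hd1 E]]. destruct E' as [d2 [Hd2 E']].
  exists (Rmin d1 d2). split; [now apply Rmin_pos |].
  assert (K1 := Rmin_l d1 d2). assert (K2 := Rmin_r d1 d2). split.
  - intros u Hu. apply (ex_RInt_ext h); [| now apply ex_RInt_continuous_R].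
    rewrite Rmin_left, Rmax_right by lra. intros s Hs. symmetry. apply E'. lra.
  - intros v Hv. apply (ex_RInt_ext g); [| now apply ex_RInt_continuous_R].
    rewrite Rmin_left, Rmax_right by lra. intros s Hs. symmetry. apply E. lra.
Qed.

(** The supremum c of the points up to which f is integrable is itself such a point by integrability
    just left of c, and integrability just right of c would push it further if c < b. *)
Lemma piecewise_continuous_ex_RInt (f : R -> R) (a b : R) :
  a <= b -> piecewise_continuous f -> ex_RInt f a b.
Proof.
  intros Hab Hf.
  set (E := fun v => a <= v <= b /\ ex_RInt f a v).
  assert (Ha : E a) by (split; [lra | apply ex_RInt_point]).
  destruct (completeness E) as [c [Hub Hlub]].
  - exists b. intros v [Hv _]. lra.
  - now exists a.
  - assert (Hac : a <= c) by now apply Hub.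
    assert (Hcb : c <= b) by (apply Hlub; intros v [Hv _]; lra).
    destruct (piecewise_continuous_locally_ex_RInt f c Hf) as [d [Hd [Hl Hr]]].
    assert (Hc : ex_RInt f a c).
    { destruct (excluded_middle_informative (exists v, E v /\ c - d < v)) as [[v [[Hv Hav] Hvd]] | Hno].
      - apply (ex_RInt_Chasles f a v c); auto. apply Hl. split; auto. apply Hub. now split.
      - exfalso. assert (c <= c - d); [| lra]. apply Hlub. intros v Hv.
        apply Rnot_lt_le. intros K. apply Hno. now exists v. }
    destruct (Rle_lt_dec b c) as [H | H].
    + now replace b with c by lra.
    + exfalso. set (v := Rmin b (c + d / 2)).
      assert (K1 := Rmin_l b (c + d / 2)). assert (K2 := Rmin_r b (c + d / 2)).
      assert (K3 : c < v) by (apply Rmin_glb_lt; lra).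
      assert (E v); [| assert (v <= c) by (now apply Hub); lra].
      split; [unfold v in *; lra |].
      apply (ex_RInt_Chasles f a c v); auto. apply Hr. unfold v in *. lra.
Qed.

(** * Piecewise continuity under pruning *)

Lemma P1_piecewise_continuous (K : region) :
  piecewise_continuous (ell K) -> piecewise_continuous (upp K) ->
  piecewise_continuous (ell (P1 K)) /\ piecewise_continuous (upp (P1 K)).
Proof.
  intros Hl Hu. split; simpl.
  - apply piecewise_continuous_ite; [apply one_sided_definite_eq | apply piecewise_continuous_const |].
    apply piecewise_continuous_ite; auto.
    + repeat apply one_sided_definite_or; apply one_sided_definite_interval.
    + apply piecewise_continuous_Rmax; auto. apply piecewise_continuous_const.
  - assert (Hv : piecewise_continuous (fun t => ite (t = 1) (Rmin (M_max K) (upp K 1)) (upp K t))).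
    { apply piecewise_continuous_ite; auto; [apply one_sided_definite_eq | apply piecewise_continuous_const]. }
    apply piecewise_continuous_ite; auto.
    + apply one_sided_definite_or; apply one_sided_definite_interval.
    + apply piecewise_continuous_Rmin; auto. apply piecewise_continuous_const.
Qed.

(** The common form of [upp''] and [ell''], with the extremal slopes at the grid points frozen into
    [c] and [c']. *)
Definition grid_values (Delta : R) (G : R -> Prop) (f : R -> R) (c c' : Z -> R) (t y : R) : Prop :=
  exists (n : Z) (s : R), let t0 := IZR n * Delta in
    G t0 /\ 0 <= s <= Delta /\
    ((t = t0 + s /\ y = f t0 + s * c n) \/ (t = t0 - s /\ y = f t0 - s * c' n)).

Lemma grid_cell (Delta : R) (F : (R -> Prop) -> Prop) :
  0 < Delta -> one_sided F ->
  exists n : Z, F (fun s => IZR n * Delta < s < IZR n * Delta + Delta).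
Proof.
  intros HD [t [-> | ->]].
  - destruct (fundamental_domain Delta 0 t HD) as [n Hn]. exists n.
    apply at_right_iff. exists (IZR n * Delta + Delta - t). split; [lra |]. intros s Hs. lra.
  (* Reflection makes the cell half-open on the other side, so that a grid point t gets the cell to
     its left. *)
  - destruct (fundamental_domain Delta 0 (- t) HD) as [n Hn]. exists (- n - 1)%Z.
    rewrite minus_IZR, opp_IZR.
    apply at_left_iff. exists (t - (- IZR n - 1) * Delta). split; [lra |]. intros s Hs. lra.
Qed.

(** Inside an open cell only its two end points are within reach, so the set has at most two
    elements, each affine in t. *)
Lemma grid_values_in_cell (Delta : R) (G : R -> Prop) (f : R -> R) (c c' : Z -> R) (n : Z) (t y : R) :
  0 < Delta -> IZR n * Delta < t < IZR n * Delta + Delta ->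
  (grid_values Delta G f c c' t y <->
    (G (IZR n * Delta) /\ y = f (IZR n * Delta) + (t - IZR n * Delta) * c n) \/
    (G (IZR (n + 1) * Delta) /\
       y = f (IZR (n + 1) * Delta) - (IZR (n + 1) * Delta - t) * c' (n + 1)%Z)).
Proof.
  intros HD Ht. split.
  - intros [m [s [HG [Hs [[-> ->] | [-> ->]]]]]].
    + left. assert (m = n) as ->.
      { assert (IZR m < IZR (n + 1)) by (rewrite plus_IZR; apply (Rmult_lt_reg_r Delta); lra).
        assert (IZR (n - 1) < IZR m) by (rewrite minus_IZR; apply (Rmult_lt_reg_r Delta); lra).
        apply lt_IZR in H. apply lt_IZR in H0. lia. }
      split; auto. f_equal. ring.
    + right. assert (m = (n + 1)%Z) as ->.
      { assert (IZR n < IZR m) by (apply (Rmult_lt_reg_r Delta); lra).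
        assert (IZR m < IZR (n + 2)) by (rewrite plus_IZR; apply (Rmult_lt_reg_r Delta); lra).
        apply lt_IZR in H. apply lt_IZR in H0. lia. }
      split; auto. f_equal. ring.
  - intros [[HG ->] | [HG ->]].
    + exists n, (t - IZR n * Delta). split; auto. split; [lra |]. left. split; [ring | auto].
    + exists (n + 1)%Z, (IZR (n + 1) * Delta - t). split; auto.
      split; [rewrite plus_IZR; lra |]. right. split; [ring | auto].
Qed.

Lemma piecewise_continuous_affine (a b : R) : piecewise_continuous (fun t => a * t + b).
Proof.
  apply piecewise_continuous_of_continuous. intros t.
  apply (ex_derive_continuous (fun t : R => a * t + b)). auto_derive. auto.
Qed.

Lemma piecewise_continuous_if (Q : Prop) (f g : R -> R) :
  piecewise_continuous f -> piecewise_continuous g ->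
  piecewise_continuous (fun t => ite Q (f t) (g t)).
Proof.
  intros Hf Hg. apply (piecewise_continuous_ite (fun _ => Q)); auto.
  intros F HF. pose proof (one_sided_filter F HF).
  destruct (excluded_middle_informative Q); [left | right]; now apply filter_forall.
Qed.

Section GridEnvelope.
Context (Delta : R) (G : R -> Prop) (f : R -> R) (c c' : Z -> R).
Context (HD : 0 < Delta) (Hf : piecewise_continuous f).

Lemma grid_Inf_piecewise_continuous :
  piecewise_continuous (fun t => Inf (fun y => y = f t \/ grid_values Delta G f c c' t y)).
Proof.
  apply piecewise_continuous_patch. intros F HF. pose proof (one_sided_filter F HF).
  destruct (grid_cell Delta F HD HF) as [n Hn].
  set (l1 := fun t => f (IZR n * Delta) + (t - IZR n * Delta) * c n).
  set (l2 := fun t => f (IZR (n + 1) * Delta) - (IZR (n + 1) * Delta - t) * c' (n + 1)%Z).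
  (* An end point outside [G] contributes [f t], which does not change the minimum. *)
  exists (fun t => Rmin (f t) (Rmin (ite (G (IZR n * Delta)) (l1 t) (f t))
                                    (ite (G (IZR (n + 1) * Delta)) (l2 t) (f t)))).
  split.
  - apply piecewise_continuous_Rmin; auto.
    apply piecewise_continuous_Rmin; apply piecewise_continuous_if; auto.
    + replace l1 with (fun t => c n * t + (f (IZR n * Delta) - IZR n * Delta * c n));
        [apply piecewise_continuous_affine |].
      apply FunctionalExtensionality.functional_extensionality. intros t. unfold l1. ring.
    + replace l2 with (fun t => c' (n + 1)%Z * t
                         + (f (IZR (n + 1) * Delta) - IZR (n + 1) * Delta * c' (n + 1)%Z));
        [apply piecewise_continuous_affine |].
      apply FunctionalExtensionality.functional_extensionality. intros t. unfold l2. ring.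
  - revert Hn. apply filter_imp. intros t Ht.
    assert (Hcell := fun y => grid_values_in_cell Delta G f c c' n t y HD Ht).
    fold (l1 t) (l2 t) in Hcell.
    set (v := Rmin _ _).
    assert (Hlow : forall y, y = f t \/ grid_values Delta G f c c' t y -> v <= y).
    { unfold v. intros y [-> | Hy]; [apply Rmin_l |].
      apply Hcell in Hy. eapply Rle_trans; [apply Rmin_r |].
      destruct Hy as [[HG ->] | [HG ->]].
      - eapply Rle_trans; [apply Rmin_l |]. rewrite ite_true by auto. apply Rle_refl.
      - eapply Rle_trans; [apply Rmin_r |]. rewrite ite_true by auto. apply Rle_refl. }
    assert (Hv : v = f t \/ grid_values Delta G f c c' t v).
    { unfold v. apply Rmin_case; auto. apply Rmin_case; apply ite_ind; auto;
        intros HG; right; apply Hcell; auto. }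
    apply Rle_antisym.
    + now apply (Inf_lower _ _ v).
    + now apply (Inf_greatest _ v).
Qed.

Lemma grid_Sup_piecewise_continuous :
  piecewise_continuous (fun t => Sup (fun y => y = f t \/ grid_values Delta G f c c' t y)).
Proof.
  apply piecewise_continuous_patch. intros F HF. pose proof (one_sided_filter F HF).
  destruct (grid_cell Delta F HD HF) as [n Hn].
  set (l1 := fun t => f (IZR n * Delta) + (t - IZR n * Delta) * c n).
  set (l2 := fun t => f (IZR (n + 1) * Delta) - (IZR (n + 1) * Delta - t) * c' (n + 1)%Z).
  exists (fun t => Rmax (f t) (Rmax (ite (G (IZR n * Delta)) (l1 t) (f t))
                                    (ite (G (IZR (n + 1) * Delta)) (l2 t) (f t)))).
  split.
  - apply piecewise_continuous_Rmax; auto.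
    apply piecewise_continuous_Rmax; apply piecewise_continuous_if; auto.
    + replace l1 with (fun t => c n * t + (f (IZR n * Delta) - IZR n * Delta * c n));
        [apply piecewise_continuous_affine |].
      apply FunctionalExtensionality.functional_extensionality. intros t. unfold l1. ring.
    + replace l2 with (fun t => c' (n + 1)%Z * t
                         + (f (IZR (n + 1) * Delta) - IZR (n + 1) * Delta * c' (n + 1)%Z));
        [apply piecewise_continuous_affine |].
      apply FunctionalExtensionality.functional_extensionality. intros t. unfold l2. ring.
  - revert Hn. apply filter_imp. intros t Ht.
    assert (Hcell := fun y => grid_values_in_cell Delta G f c c' n t y HD Ht).
    fold (l1 t) (l2 t) in Hcell.
    set (v := Rmax _ _).
    assert (Hupp : forall y, y = f t \/ grid_values Delta G f c c' t y -> y <= v).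
    { unfold v. intros y [-> | Hy]; [apply Rmax_l |].
      apply Hcell in Hy. eapply Rle_trans; [| apply Rmax_r].
      destruct Hy as [[HG ->] | [HG ->]].
      - eapply Rle_trans; [| apply Rmax_l]. rewrite ite_true by auto. apply Rle_refl.
      - eapply Rle_trans; [| apply Rmax_r]. rewrite ite_true by auto. apply Rle_refl. }
    assert (Hv : v = f t \/ grid_values Delta G f c c' t v).
    { unfold v. apply Rmax_case; auto. apply Rmax_case; apply ite_ind; auto;
        intros HG; right; apply Hcell; auto. }
    apply Rle_antisym.
    + now apply (Sup_least _ v).
    + now apply (Sup_upper _ _ v).
Qed.

End GridEnvelope.

Lemma P2_piecewise_continuous (P : params) (G : R -> Prop) (K : region) :
  (0 < n_time P)%nat ->
  piecewise_continuous (ell K) -> piecewise_continuous (upp K) ->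
  piecewise_continuous (ell (P2 P G K)) /\ piecewise_continuous (upp (P2 P G K)).
Proof.
  intros Ht Hl Hu.
  assert (Hstep : 0 < / INR (n_time P)) by now apply Rinv_0_lt_compat, lt_0_INR.
  split.
  - exact (grid_Sup_piecewise_continuous (/ INR (n_time P)) G (ell K)
      (fun n => Inf (slopes P K (IZR n * / INR (n_time P)) 1))
      (fun n => Sup (slopes P K (IZR n * / INR (n_time P)) (-1))) Hstep Hl).
  - exact (grid_Inf_piecewise_continuous (/ INR (n_time P)) G (upp K)
      (fun n => Sup (slopes P K (IZR n * / INR (n_time P)) 1))
      (fun n => Inf (slopes P K (IZR n * / INR (n_time P)) (-1))) Hstep Hu).
Qed.

(** * The refined region [K2] *)

Lemma RInt_window_bounded (f : R -> R) (a b c d B : R) :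
  c <= d -> piecewise_continuous f ->
  (forall t, a + c <= t <= b + d -> 0 <= f t <= B) ->
  forall r, a <= r <= b -> 0 <= RInt f (r + c) (r + d) <= (d - c) * B.
Proof.
  intros Hcd Hf HB r Hr.
  assert (Hex : ex_RInt f (r + c) (r + d)) by (apply piecewise_continuous_ex_RInt; auto; lra).
  split.
  - apply RInt_ge_0; auto; [lra |]. intros t Ht. apply HB. lra.
  - apply Rle_trans with (Rabs (RInt f (r + c) (r + d))); [apply Rle_abs |].
    replace (d - c) with (r + d - (r + c)) by ring.
    apply abs_RInt_le_const; auto; [lra |]. intros t Ht.
    destruct (HB t) as [H1 H2]; [lra |]. now rewrite Rabs_pos_eq.
Qed.

Section Refined.
Context (P : params) {alpha : R} {x : R -> R} {q qb : R} (W : wave alpha x q qb).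
Context (Hmin : PI / 2 < alpha_min P) (Halpha : alpha_min P <= alpha <= alpha_max P)
  (Htime : (0 < n_time P)%nat) (Hqb3 : 3 <= qb).

(** What the refinement must preserve for the qbar interval: enclosure, integrable bounds and a
    nonzero divisor. *)
Definition refinable (K : region) : Prop :=
  encloses K x q qb /\ piecewise_continuous (ell K) /\ piecewise_continuous (upp K) /\
  upp K (-1) < 0.

(** With c = -t this makes the initial upper bound linear in t on [-1, 0), from which its piecewise
    continuity is read off. *)
Lemma sup_alpha_scal (c : R) :
  0 < c -> sup_alpha P (fun alpha => c * a_seq (j0 P) alpha) = c * sup_alpha P (a_seq (j0 P)).
Proof.
  intros Hc. assert (Hone := PI2_1).
  assert (Hneg : forall a, alpha_min P <= a <= alpha_max P -> a_seq (j0 P) a <= 0).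
  { intros a Ha. apply Rlt_le, a_iter_neg. lra. }
  apply Rle_antisym.
  - apply (Sup_least _ (c * a_seq (j0 P) alpha)); [now exists alpha |].
    intros z [a [Ha ->]]. apply Rmult_le_compat_l; [lra |].
    now apply (sup_on_upper _ _ (a_seq (j0 P)) a 0).
  - apply (Rmult_le_reg_l (/ c)); [now apply Rinv_0_lt_compat |].
    rewrite <- Rmult_assoc, Rinv_l, Rmult_1_l by lra.
    apply (Sup_least _ (a_seq (j0 P) alpha)); [now exists alpha |].
    intros z [a [Ha ->]]. apply (Rmult_le_reg_l c); auto.
    rewrite <- Rmult_assoc, Rinv_r, Rmult_1_l by lra.
    apply (sup_on_upper _ _ (fun alpha => c * a_seq (j0 P) alpha) a 0); auto.
    intros b Hb. specialize (Hneg b Hb). nra.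
Qed.

Lemma K2_start_refinable : refinable (K2_start P).
Proof.
  split; [now apply (K2_start_encloses P W) |].
  destruct (wave_p_iter_bounds W (alpha_max P) (i0 P - 1)) as [Hpc _]; [lra |].
  split; [| split; [| now apply (K2_start_upp_minus_1 P Hmin Halpha)]]; simpl.
  - apply piecewise_continuous_ite; [apply one_sided_definite_eq | apply piecewise_continuous_const |].
    apply piecewise_continuous_ite; [apply one_sided_definite_lt | | apply piecewise_continuous_const].
    now apply piecewise_continuous_of_continuous.
  - set (S := sup_alpha P (a_seq (j0 P))).
    assert (HS : forall t, ite (-1 <= t < 0) (sup_alpha P (fun alpha => - t * a_seq (j0 P) alpha)) (p_i0 P 1)
                  = ite (-1 <= t < 0) (- S * t + 0) (p_i0 P 1)).
    { intros t. apply ite_ind; intros Ht; [rewrite ite_true by auto | now rewrite ite_false by auto].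
      replace (- S * t + 0) with (- t * S) by ring. apply sup_alpha_scal. lra. }
    apply (piecewise_continuous_ext (fun t => ite (t = 0) 0 (ite (-1 <= t < 0) (- S * t + 0) (p_i0 P 1)))).
    { intros t. now rewrite HS. }
    apply piecewise_continuous_ite; [apply one_sided_definite_eq | apply piecewise_continuous_const |].
    apply piecewise_continuous_ite; [ | | apply piecewise_continuous_const].
    + apply one_sided_definite_and; [apply one_sided_definite_ge | apply one_sided_definite_lt].
    + exact (piecewise_continuous_affine (- S) 0).
Qed.

Lemma P1_refinable (K : region) : refinable K -> refinable (P1 K).
Proof.
  intros [HK [Hl [Hu H1]]].
  destruct (P1_piecewise_continuous K Hl Hu) as [Hl' Hu'].
  split; [now apply (P1_encloses W) |]. split; auto. split; auto.
  simpl. rewrite (ite_false (-1 = 1)) by lra. apply ite_ind; intros _; auto.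
  apply Rle_lt_trans with (2 := H1). apply Rmin_r.
Qed.

Lemma P2_refinable (G : R -> Prop) (K : region) : refinable K -> refinable (P2 P G K).
Proof.
  intros [HK [Hl [Hu H1]]].
  destruct (P2_piecewise_continuous P G K Htime Hl Hu) as [Hl' Hu'].
  split; [now apply (P2_encloses P W) |]. split; auto. split; auto.
  apply Rle_lt_trans with (2 := H1).
  now apply (P2_upp_between P W).
Qed.

Lemma K2_refined_refinable : exists K, K2_refined P = Some K /\ refinable K.
Proof.
  unfold K2_refined.
  assert (H : forall n, refinable (Nat.iter n (P2 P (fun t0 => -4 <= t0 <= 4)) (P1 (K2_start P)))).
  { induction n as [| n IH]; simpl.
    - apply P1_refinable, K2_start_refinable.
    - now apply P2_refinable. }
  destruct (H (n_period P)) as [HK [Hl [Hu H1]]].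
  destruct (P3_encloses W _ HK) as [K' [E [HK' [El Eu]]]].
  exists K'. split; auto. split; auto. rewrite El, Eu. auto.
Qed.

(** The equation integrated: e^x - 1 over a window records the drop of x over the same window one
    delay later. *)
Lemma wave_RInt_exp (a b : R) :
  alpha * RInt (fun t => exp (x t) - 1) a b = x (a + 1) - x (b + 1).
Proof.
  assert (H : is_RInt (fun t => - alpha * (exp (x t) - 1)) a b (x (b + 1) - x (a + 1))).
  { apply (is_RInt_derive (V := R_CompleteNormedModule) (fun t => x (t + 1))).
    - intros t _. assert (D := wave_derive W (t + 1)). replace (t + 1 - 1) with t in D by ring.
      auto_derive; [eexists; exact D |].
      rewrite (is_derive_unique (fun r : R => x r) _ _ D). ring.
    - intros t _. apply (continuous_comp x (fun y => - alpha * (exp y - 1))); [apply (wave_continuous W) |].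
      apply (ex_derive_continuous (fun y : R => - alpha * (exp y - 1))). auto_derive. auto. }
  apply (is_RInt_unique (V := R_CompleteNormedModule)) in H.
  assert (K := RInt_scal (V := R_CompleteNormedModule) (fun t => exp (x t) - 1) a b (- alpha)).
  unfold scal in K; simpl in K. unfold mult in K; simpl in K.
  rewrite K in H; [lra |].
  apply ex_RInt_continuous_R. intros t.
  apply (continuous_comp x (fun y => exp y - 1)); [apply (wave_continuous W) |].
  apply (ex_derive_continuous (fun y : R => exp y - 1)). auto_derive. auto.
Qed.

(** Two windows of the integrated equation carry x from its zero at q to q + 2 and give alpha (Ip -
    In) = -x(q+2). The remaining climb to 0 lasts qb - 2, with slopes between alpha (1 - e^{x(-1)})
    and alpha (1 - e^{min x}); this encloses qb - 2 between quotients of Ip - In. The algorithm's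
    four integrals enclose Ip and In, while [m] and u(-1) enclose the two denominators. *)
Lemma K2_encloses : exists K, K2 P = Some K /\ encloses K x q qb.
Proof.
  destruct K2_refined_refinable as [K [E [HK [Hl [Hu Hneg]]]]].
  unfold K2. rewrite E. cbv zeta.
  pose proof (wave_alpha _ _ _ _ W) as Ha.
  pose proof (wave_q _ _ _ _ W) as Hq1.
  assert (Hell := enc_ell _ _ _ _ HK). assert (Hupp := enc_upp _ _ _ _ HK).
  assert (Hbox := enc_box _ _ _ _ HK). simpl in Hbox. destruct Hbox as [Hq [Hqb HM]].
  set (fp := fun t => Rmax (exp (upp K t) - 1) 0).
  set (fl := fun t => Rmax (exp (ell K t) - 1) 0).
  set (nl := fun t => - Rmin (exp (ell K t) - 1) 0).
  set (nu := fun t => - Rmin (exp (upp K t) - 1) 0).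
  assert (Hexp : forall f, piecewise_continuous f -> piecewise_continuous (fun t => exp (f t) - 1)).
  { intros f. apply (piecewise_continuous_comp (fun y => exp y - 1)). intros y.
    apply (ex_derive_continuous (fun y : R => exp y - 1)). auto_derive. auto. }
  assert (Hopp : forall f, piecewise_continuous f -> piecewise_continuous (fun t => - f t)).
  { intros f. apply (piecewise_continuous_comp (fun y => - y)). intros y.
    apply (ex_derive_continuous (fun y : R => - y)). auto_derive. auto. }
  assert (Cfp : piecewise_continuous fp)
    by (apply piecewise_continuous_Rmax; auto; apply piecewise_continuous_const).
  assert (Cfl : piecewise_continuous fl)
    by (apply piecewise_continuous_Rmax; auto; apply piecewise_continuous_const).
  assert (Cnl : piecewise_continuous nl)
    by (apply Hopp, piecewise_continuous_Rmin; auto; apply piecewise_continuous_const).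
  assert (Cnu : piecewise_continuous nu)
    by (apply Hopp, piecewise_continuous_Rmin; auto; apply piecewise_continuous_const).
  assert (Hmax0 : forall y, 0 <= Rmax y 0) by (intros; apply Rmax_r).
  assert (Hmin0 : forall y, 0 <= - Rmin y 0) by (intros y; assert (K0 := Rmin_r y 0); lra).
  assert (Hmin1 : forall y, - Rmin (exp y - 1) 0 <= 1).
  { intros y. assert (K0 := exp_pos y). unfold Rmin. destruct Rle_dec; lra. }
  assert (Cx : forall t, continuous (fun t => exp (x t) - 1) t).
  { intros t. apply (continuous_comp x (fun y => exp y - 1)); [apply (wave_continuous W) |].
    apply (ex_derive_continuous (fun y : R => exp y - 1)). auto_derive. auto. }
  set (Ip := RInt (fun t => exp (x t) - 1) (q - 1) q).
  set (In := RInt (fun t => - (exp (x t) - 1)) q (q + 1)).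
  assert (HIp : alpha * Ip = - x (1 + q)).
  { unfold Ip. rewrite wave_RInt_exp. replace (q - 1 + 1) with q by ring.
    rewrite (wave_zq W), (Rplus_comm q 1). ring. }
  assert (HIn : alpha * In = x (q + 2) - x (1 + q)).
  { unfold In.
    assert (K0 := RInt_opp (V := R_CompleteNormedModule) (fun t => exp (x t) - 1) q (q + 1)
      (ex_RInt_continuous_R _ _ _ Cx)).
    unfold opp in K0; simpl in K0. rewrite K0.
    assert (K1 := wave_RInt_exp q (q + 1)). replace (q + 1 + 1) with (q + 2) in K1 by ring.
    rewrite (Rplus_comm q 1) in K1. rewrite (Rplus_comm q 1). lra. }
  assert (Hlow : (qb - 2) * (1 - exp (x (-1))) <= Ip - In).
  { assert (H1 : alpha * (1 - exp (x (-1))) * ((q + qb) - (q + 2)) <= x (q + qb) - x (q + 2)).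
    { apply (is_derive_bound_below x (fun t => - alpha * (exp (x (t - 1)) - 1))); [lra | |].
      - intros; apply (wave_derive W).
      - intros r Hr. assert (K0 : x (r - 1) <= x (-1)).
        { rewrite <- (wave_per_sub W (r - 1)). apply (wave_increasing_le W); lra. }
        apply exp_le in K0. nra. }
    rewrite (wave_zL W) in H1. apply (Rmult_le_reg_l alpha); auto.
    lra. }
  assert (Hhigh : Ip - In <= (qb - 2) * (1 - exp (x (1 + q)))).
  { assert (H1 : x (q + qb) - x (q + 2) <= alpha * (1 - exp (x (1 + q))) * ((q + qb) - (q + 2))).
    { apply (is_derive_bound_above x (fun t => - alpha * (exp (x (t - 1)) - 1))); [lra | |].
      - intros; apply (wave_derive W).
      - intros r Hr. assert (K0 := proj1 (wave_range W (r - 1))).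
        apply exp_le in K0. nra. }
    rewrite (wave_zL W) in H1. apply (Rmult_le_reg_l alpha); auto.
    lra. }
  set (Up := sup_on (q_min K) (q_max K) (fun r => RInt fp (r - 1) r)).
  set (Lp := inf_on (q_min K) (q_max K) (fun r => RInt fl (r - 1) r)).
  set (Un := sup_on (q_min K) (q_max K) (fun r => RInt nl r (r + 1))).
  set (Ln := inf_on (q_min K) (q_max K) (fun r => RInt nu r (r + 1))).
  set (m := inf_on (q_min K) (q_max K) (fun t => ell K (t + 1))).
  assert (HUp : Ip <= Up).
  { destruct (enc_upp_bounded _ _ _ _ HK (q_min K + -1) (q_max K + 0)) as [B HB].
    apply Rle_trans with (RInt fp (q - 1) q).
    - apply RInt_le; [lra | now apply ex_RInt_continuous_R
        | apply piecewise_continuous_ex_RInt; auto; lra |].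
      intros t Ht. eapply Rle_trans; [| apply Rmax_l]. assert (K0 := exp_le _ _ (Hupp t)). lra.
    - apply (sup_on_upper _ _ (fun r => RInt fp (r - 1) r) _ ((0 - -1) * exp B)); auto.
      intros r Hr.
      assert (K0 := RInt_window_bounded fp (q_min K) (q_max K) (-1) 0 (exp B)).
      rewrite <- (Rplus_0_r r) at 2. apply K0; auto; [lra |].
      intros t Ht. split; [apply Hmax0 |].
      assert (K1 := exp_le _ _ (HB t Ht)). assert (K2 := exp_pos B).
      apply Rmax_lub; lra. }
  assert (HLp : Lp <= Ip).
  { apply Rle_trans with (RInt fl (q - 1) q).
    - apply (inf_on_lower _ _ (fun r => RInt fl (r - 1) r) _ 0); auto.
      intros r Hr. apply RInt_ge_0; [lra | apply piecewise_continuous_ex_RInt; auto; lra |].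
      intros; apply Hmax0.
    - apply RInt_le; [lra | apply piecewise_continuous_ex_RInt; auto; lra
        | now apply ex_RInt_continuous_R |].
      (* The truncation at 0 does no harm: x >= 0 on [q - 1, q], so e^x - 1 is nonnegative there. *)
      intros t Ht. apply Rmax_lub.
      + assert (K0 := exp_le _ _ (Hell t)). lra.
      + assert (K0 : 0 <= x t) by (apply (wave_nonneg W); lra).
        apply exp_le in K0. rewrite exp_0 in K0. lra. }
  assert (Cxn : forall t, continuous (fun t => - (exp (x t) - 1)) t).
  { intros t. now apply (continuous_opp (fun t => exp (x t) - 1)). }
  assert (HUn : In <= Un).
  { apply Rle_trans with (RInt nl q (q + 1)).
    - apply RInt_le; [lra | now apply ex_RInt_continuous_R
        | apply piecewise_continuous_ex_RInt; auto; lra |].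
      intros t Ht. apply Ropp_le_contravar. eapply Rle_trans; [apply Rmin_l |].
      assert (K0 := exp_le _ _ (Hell t)). lra.
    - apply (sup_on_upper _ _ (fun r => RInt nl r (r + 1)) _ ((1 - 0) * 1)); auto.
      intros r Hr.
      assert (K0 := RInt_window_bounded nl (q_min K) (q_max K) 0 1 1).
      rewrite <- (Rplus_0_r r) at 1. apply K0; auto; [lra |].
      intros t Ht. split; [apply Hmin0 | apply Hmin1]. }
  assert (HLn : Ln <= In).
  { apply Rle_trans with (RInt nu q (q + 1)).
    - apply (inf_on_lower _ _ (fun r => RInt nu r (r + 1)) _ 0); auto.
      intros r Hr. apply RInt_ge_0; [lra | apply piecewise_continuous_ex_RInt; auto; lra |].
      intros; apply Hmin0.
    - apply RInt_le; [lra | apply piecewise_continuous_ex_RInt; auto; lra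
        | now apply ex_RInt_continuous_R |].
      intros t Ht. apply Ropp_le_contravar. apply Rmin_glb.
      + assert (K0 := exp_le _ _ (Hupp t)). lra.
      + assert (K0 : x t <= 0) by (apply (wave_nonpos W); lra).
        apply exp_le in K0. rewrite exp_0 in K0. lra. }
  assert (Hm : m <= x (1 + q)).
  { destruct (enc_ell_bounded _ _ _ _ HK (q_min K + 1) (q_max K + 1)) as [B HB].
    apply Rle_trans with (ell K (q + 1)); [| rewrite Rplus_comm; apply Hell].
    apply (inf_on_lower _ _ (fun t => ell K (t + 1)) _ B); auto.
    intros s Hs. apply HB. lra. }
  assert (Hxm := exp_lt_1 _ (wave_min_neg W)).
  assert (Hem := exp_le _ _ Hm).
  assert (Heu := exp_lt_1 _ Hneg).
  assert (Hxu := exp_le _ _ (Hupp (-1))).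
  (* [Lp - Un] may be negative, so the comparison is made after multiplying out; enlarging 1 -
     e^{min x} to 1 - e^m is sound because qb - 2 > 0. *)
  assert (Hmin' : 2 + (Lp - Un) / Rabs (exp m - 1) <= qb).
  { rewrite Rabs_left by lra.
    apply (Rmult_le_reg_r (- (exp m - 1))); [lra |].
    replace ((2 + (Lp - Un) / - (exp m - 1)) * - (exp m - 1))
      with (2 * - (exp m - 1) + (Lp - Un)) by (field; lra).
    assert ((qb - 2) * (1 - exp (x (1 + q))) <= (qb - 2) * (1 - exp m))
      by (apply Rmult_le_compat_l; lra).
    lra. }
  assert (Hmax' : qb <= 2 + (Up - Ln) / Rabs (exp (upp K (-1)) - 1)).
  { rewrite Rabs_left by lra.
    apply (Rmult_le_reg_r (- (exp (upp K (-1)) - 1))); [lra |].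
    replace ((2 + (Up - Ln) / - (exp (upp K (-1)) - 1)) * - (exp (upp K (-1)) - 1))
      with (2 * - (exp (upp K (-1)) - 1) + (Up - Ln)) by (field; lra).
    assert ((qb - 2) * (1 - exp (upp K (-1))) <= (qb - 2) * (1 - exp (x (-1))))
      by (apply Rmult_le_compat_l; lra).
    lra. }
  (* The upper end is at least qb >= 3, so the region is not discarded. *)
  rewrite ite_false by lra.
  eexists. split; [reflexivity |].
  constructor; simpl; auto; try apply HK.
Qed.

End Refined.

Theorem theorem5p2
  (amin amax e1 e2 : R) (i j nTime nPeriod nPrune : nat)
  (hamin : PI / 2 < amin) (hamax : amin <= amax)
  (he1 : 0 < e1) (he2 : 0 < e2)
  (hi : (0 < i)%nat) (hj : (0 < j)%nat) (hnTime : (0 < nTime)%nat)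
  (hnPeriod : (0 < nPeriod)%nat) (hnPrune : (0 < nPrune)%nat)
  (A : list region)
  (hA : bp_output (Params amin amax e1 e2 i j nTime nPeriod nPrune) A) :
  exhaustive amin amax (fun k => exists K, In K A /\ in_box K k).
Proof.
  set (P := Params amin amax e1 e2 i j nTime nPeriod nPrune) in *.
  intros alpha x Halpha Hsops HX.
  assert (HPI := PI_RGT_0).
  destruct (SOPS_wave alpha x ltac:(lra) Hsops HX) as [q [qb W]].
  exists (q, qb, x 1). split; [apply (wave_is_kappa W) |].
  apply (bp_output_covered P W hamin Halpha); auto.
  unfold bp_init.
  destruct (Rle_lt_dec qb 3) as [H | H].
  - exists (K1 P). split; [now left | now apply (K1_encloses P W)].
  - destruct (K2_encloses P W hamin Halpha hnTime ltac:(lra)) as [K [-> HK]].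
    exists K. split; [right; now left | exact HK].
Qed.
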